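(* Let $k$ be an algebraically closed field of characteristic $0$. Let $R$ be a prime $k$-algebra with center $B$, and $A\subset B$ a finitely generated $k$-subalgebra such that $R$ is a finitely generated $A$-module and $A$, $B$ are integrally closed. Let $\pi:V(B)\to V(A)$ be the induced map of maximal spectra. Let $Q\in V(A)$ with maximal ideal $\mathfrak m$, write $B/\mathfrak mB=\bigoplus_{i=1}^sB_i$ with $B_i$ local with unit $e_i$, corresponding to the points $P_1,\dots,P_s$ of $\pi^{-1}(Q)$, and let $h_i\in k$ be the value at $e_i$ of the $k$-linear map $B/\mathfrak mB\to k$ induced by $t_{B/A}$. Then each $h_i$ is a positive integer, $\sum_ih_i=[B:A]$, and $$N_Q\cong\bigoplus_{i=1}^s M_{P_i}^{\oplus h_i},$$ where $N_Q$ is the semisimple representation of $R$ of dimension $[R:A]$ attached to $Q$ (for the trace $t_{R/A}$) and $M_{P}$ is the semisimple representation of $R$ of dimension $[R:B]$ attached to $P\in V(B)$ (for the trace $t_{R/B}$).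
   Context: For a prime ring $R$ finite over an integrally closed central subring $A$ with fraction field $F$: $S=R\otimes_AF\cong M_k(D)$, $D$ a division ring with center $Z$, $\dim_ZD=h^2$, $p=[Z:F]$, $[R:A]:=hkp$, and the reduced trace $t_{R/A}$ is the restriction of $t_{S/F}(a)=\frac1{hk}\operatorname{tr}_F(L_a)$; it takes values in $A$ and makes $R$ an $[R:A]$-Cayley–Hamilton algebra. For an $n$-Cayley–Hamilton algebra $R$ finitely generated over $k$ with trace algebra $T$, each point $p$ of $V(T)$ (maximal spectrum) corresponds to a unique isomorphism class of $n$-dimensional semisimple representations $\rho$ with $\operatorname{tr}\rho(a)=p(t(a))$. *)

(* Defs.v *)
From HB Require Import structures.
From mathcomp Require Import all_boot all_order all_algebra.
Set Implicit Arguments. Unset Strict Implicit. Unset Printing Implicit Defensive.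
Import Order.TTheory GRing.Theory Num.Theory.
Local Open Scope ring_scope.

Section Defs.
Variables (K : fieldType) (R : algType K).

Definition central (x : R) : Prop := forall y : R, x * y = y * x.

(* R is a prime ring (R is nonzero since it is an nzRing) *)
Definition prime_ring : Prop :=
  forall a b : R, (forall r : R, a * r * b = 0) -> a = 0 \/ b = 0.

Definition is_subalg (A : R -> Prop) : Prop :=
  [/\ A 1, (forall x y, A x -> A y -> A (x + y)),
      (forall x y, A x -> A y -> A (x * y)) & (forall (c : K) x, A x -> A (c *: x))].

Definition gen_subalg (s : seq R) (x : R) : Prop :=
  forall S : R -> Prop, is_subalg S -> (forall y, y \in s -> S y) -> S x.

Definition fg_subalg (A : R -> Prop) : Prop :=
  exists s : seq R, forall x, A x <-> gen_subalg s x.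

Definition fg_module (A : R -> Prop) : Prop :=
  exists n, exists g : 'I_n -> R, forall x : R,
    exists c : 'I_n -> R, (forall i, A (c i)) /\ x = \sum_i c i * g i.

(* a (commutative) domain S inside R is integrally closed: if a/b (b != 0)
   satisfies a monic equation over S, i.e.
   a^n + sum_{i<n} c_i a^i b^(n-i) = 0, then a/b lies in S. *)
Definition int_closed (S : R -> Prop) : Prop :=
  forall a b : R, S a -> S b -> b != 0 ->
   (exists n, exists c : 'I_n -> R, (forall i, S (c i)) /\
       a ^+ n + \sum_(i < n) c i * a ^+ i * b ^+ (n - i) = 0) ->
   exists q, S q /\ a = q * b.

Definition is_ideal (S I : R -> Prop) : Prop :=
  [/\ (forall x, I x -> S x), I 0, (forall x y, I x -> I y -> I (x + y))
    & (forall s x, S s -> I x -> I (s * x))].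

Definition is_max_ideal (S I : R -> Prop) : Prop :=
  [/\ is_ideal S I, ~ I 1 &
      forall J, is_ideal S J -> (forall x, I x -> J x) ->
        (forall x, J x <-> I x) \/ J 1].

Definition eval_at (P : R -> Prop) (x : R) (lam : K) : Prop := P (x - lam *: 1).

Definition ext_ideal (T m : R -> Prop) (x : R) : Prop :=
  exists n, exists b : 'I_n -> R, exists q : 'I_n -> R,
    (forall i, T (b i)) /\ (forall i, m (q i)) /\ x = \sum_i b i * q i.

Definition indep (S : R -> Prop) n (x : 'I_n -> R) : Prop :=
  forall c : 'I_n -> R, (forall i, S (c i)) -> \sum_i c i * x i = 0 ->
    forall i, c i = 0.

(* rank over S of the S-module M, i.e. dim_F (M (x)_S F), F = Frac S *)
Definition rank_over (S M : R -> Prop) (n : nat) : Prop :=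
  (exists x : 'I_n -> R, (forall i, M (x i)) /\ indep S x) /\
  (forall x : 'I_n.+1 -> R, (forall i, M (x i)) -> ~ indep S x).

Definition Zof (M : R -> Prop) (x : R) : Prop :=
  M x /\ forall y, M y -> x * y = y * x.

(* tau = tr_F (L_a) on M (x)_S F, computed in any F-basis x (maximal
   S-independent family of size n = rank) : writing c_j (a x_j) = sum_i al_ij x_i
   with c_j in S \ 0, tr = sum_j al_jj / c_j *)
Definition trL (S M : R -> Prop) n (a tau : R) : Prop :=
  forall (x : 'I_n -> R) (c : 'I_n -> R) (al : 'I_n -> 'I_n -> R),
    (forall i, M (x i)) -> indep S x ->
    (forall j, S (c j) /\ c j != 0) -> (forall i j, S (al i j)) ->
    (forall j, c j * (a * x j) = \sum_i al i j * x i) ->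
    (\prod_j c j) * tau = \sum_j al j j * \prod_(i | i != j) c i.

(* The reduced trace t_{M/S}(a) = t : with S (x) F = M_k(D), Z = center,
   dim_F (M (x) F) = (hk)^2 p, p = [Z:F] and t = tr_F(L_a)/(hk). *)
Definition red_trace (S M : R -> Prop) (a t : R) : Prop :=
  S t /\ exists nM nZ d, [/\ rank_over S M nM, rank_over S (Zof M) nZ,
                            nM = (d * d * nZ)%N & trL S M nM a (d%:R *: t)].

Definition degree (S M : R -> Prop) (n : nat) : Prop :=
  exists nM nZ d, [/\ rank_over S M nM, rank_over S (Zof M) nZ,
                     nM = (d * d * nZ)%N & n = (d * nZ)%N].

Definition is_rep n (rho : R -> 'M[K]_n) : Prop :=
  [/\ rho 1 = 1%:M, (forall x y, rho (x + y) = rho x + rho y),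
      (forall x y, rho (x * y) = rho x *m rho y)
    & (forall (c : K) x, rho (c *: x) = c *: rho x)].

(* semisimple: every invariant subspace (of column vectors, encoded as row
   spaces of the transposes) has an invariant complement *)
Definition semisimple n (rho : R -> 'M[K]_n) : Prop :=
  forall U : 'M[K]_n, (forall r, stablemx U (rho r)^T) ->
    exists W : 'M[K]_n, (forall r, stablemx W (rho r)^T) /\
      mxdirect (U + W) /\ (U + W == 1%:M)%MS.

Definition attached (S P : R -> Prop) n (rho : R -> 'M[K]_n) : Prop :=
  [/\ is_rep rho, semisimple rho &
      forall a t lam, red_trace S (fun _ => True) a t -> eval_at P t lam ->
        \tr (rho a) = lam].

Fixpoint dsum_rep s m (Mf : 'I_s -> R -> 'M[K]_m) (l : seq 'I_s) (r : R)
  : 'M[K]_(size l * m) :=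
  match l with
  | [::] => 0
  | i :: l' => block_mx (Mf i r) 0 0 (dsum_rep Mf l' r)
  end.

Definition iso_dsum n s m (rho : R -> 'M[K]_n) (Mf : 'I_s -> R -> 'M[K]_m)
    (h : 'I_s -> nat) : Prop :=
  let l := flatten [seq nseq (h i) i | i <- enum 'I_s] in
  exists E : (size l * m)%N = n, exists Pm : 'M[K]_n, Pm \in unitmx /\
    forall r, rho r *m Pm = Pm *m castmx (E, E) (dsum_rep Mf l r).

End Defs.

(* Main.v *)
Require Import Defs.
From HB Require Import structures.
From mathcomp Require Import all_boot all_order all_algebra.
From mathcomp Require Import perm boolp classical_sets ring.
Import Order.TTheory GRing.Theory Num.Theory.
Set Implicit Arguments. Unset Strict Implicit. Unset Printing Implicit Defensive.
Local Open Scope ring_scope.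

(** A semisimple representation in characteristic 0 is determined by its trace, and
    t_{R/A} = t_{B/A} o t_{R/B}; so everything reduces to writing the functional
    phi(b) = Q(t_{B/A}(b)) on B as the sum of h_i P_i(b).  Let chi_b be the characteristic
    polynomial of b on B (x)_A F; its coefficients lie in A.  By Cayley-Hamilton, and because
    chi_y reduces to a power of X modulo Q for y in QB, the roots of chi_b modulo Q are exactly
    the values P_i(b).  Hence phi vanishes on the intersection of the P_i, so that
    phi(b) is the sum of the phi(e_i) P_i(b), and h_i = phi(e_i) is the number of roots equal
    to 1 of chi_{e_i} modulo Q, whose roots are all 0 or 1, the value 1 being attained.

    No Nullstellensatz is needed: the field A/Q (and likewise B/P_i) is K because a
    representation with trace Q o t_{R/A} is given.  If t acts with eigenvalue lam and
    t - lam were not in Q, some q in Q would act with eigenvalue 1 although all the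
    powers of q have trace 0. *)

(** * Semisimple representations are determined by their traces *)

(** B need not be free over A, so chi_b is formed over the fraction field F of A, and no module of
    rank n over A/Q is at hand on which to reduce it. The bridge is the vector D of maximal minors
    of the coordinates of a generating family g of B. Expanding det ((X - L_b) g) shows that the
    k-th coefficient c_k of chi_b satisfies c_k D = T_k D for a square matrix T_k over A. Hence c_k
    is integral over A, so it lies in A; and if b lies in QB, then T_k can be chosen so that modulo
    Q it is the identity for k = n and 0 otherwise, which gives c_k modulo Q. The roots of chi_b
    modulo Q are located by the norm N = det L: chi_b(lam) = N(lam - b), and N(1 - y) = 1 modulo Q
    for y in QB, so lam - b cannot be invertible modulo QB when lam is a root. B is finite over A
    because in characteristic 0 the trace of R over B, divided by its rank, retracts R onto B. Both
    reduced traces of R carry the same factor 1/d, the center of R being B in either case, whereas d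
    = 1 for the commutative B over A. *)

Section RowActions.
Variables (K : fieldType) (R : algType K).

(* Subspaces are row spaces, so a representation rho acts through r |-> (rho r)^T. *)
Definition row_action n (s : R -> 'M[K]_n) : Prop :=
  [/\ s 1 = 1%:M, (forall x y, s (x + y) = s x + s y),
      (forall x y, s (x * y) = s y *m s x) & (forall (c : K) x, s (c *: x) = c *: s x)].

Definition complemented n (s : R -> 'M[K]_n) : Prop :=
  forall U : 'M[K]_n, (forall r, stablemx U (s r)) ->
    exists W : 'M[K]_n, (forall r, stablemx W (s r)) /\
      mxdirect (U + W) /\ (U + W == 1%:M)%MS.

Definition hom n m (s : R -> 'M[K]_n) (t : R -> 'M[K]_m) (f : 'M[K]_(n, m)) : Prop :=
  forall r, s r *m f = f *m t r.

Lemma hom_mul n m l (s : R -> 'M[K]_n) (t : R -> 'M[K]_m) (u : R -> 'M[K]_l) f g :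
  hom s t f -> hom t u g -> hom s u (f *m g).
Proof. by move=> hf hg r; rewrite mulmxA hf -!mulmxA hg. Qed.

Lemma hom_add n m (s : R -> 'M[K]_n) (t : R -> 'M[K]_m) f g :
  hom s t f -> hom s t g -> hom s t (f + g).
Proof. by move=> hf hg r; rewrite mulmxDl mulmxDr hf hg. Qed.

Lemma hom_opp n m (s : R -> 'M[K]_n) (t : R -> 'M[K]_m) f :
  hom s t f -> hom s t (- f).
Proof. by move=> hf r; rewrite mulmxN mulNmx hf. Qed.

Lemma hom_one n (s : R -> 'M[K]_n) : hom s s 1%:M.
Proof. by move=> r; rewrite mulmx1 mul1mx. Qed.

(** The projection along a stable complement commutes with the action. Such projections serve below
    in place of complements. *)
Lemma complemented_proj n (s : R -> 'M[K]_n) :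
  complemented s -> forall U : 'M[K]_n, (forall r, stablemx U (s r)) ->
  exists p : 'M[K]_n, [/\ hom s s p, (p <= U)%MS & U *m p = U].
Proof.
move=> cs U Ust; have [W [Wst [/mxdirect_addsP UW0 /andP[_ UW1]]]] := cs U Ust.
exists (proj_mx U W); split; last 1 first.
- exact: proj_mx_id.
- move=> r; have := add_proj_mx UW0 UW1; rewrite !mul1mx => e1.
  rewrite -{1}[s r]mul1mx -{1}e1 !mulmxDl -[RHS]addr0; congr (_ + _).
    by rewrite proj_mx_id // (submx_trans _ (Ust r)) // submxMr // -[proj_mx _ _]mul1mx proj_mx_sub.
  by rewrite proj_mx_0 // (submx_trans _ (Wst r)) // submxMr // -[proj_mx _ _]mul1mx proj_mx_sub.
by rewrite -[proj_mx _ _]mul1mx proj_mx_sub.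
Qed.

Lemma proj_complemented n (s : R -> 'M[K]_n) :
  (forall U : 'M[K]_n, (forall r, stablemx U (s r)) ->
     exists p : 'M[K]_n, [/\ hom s s p, (p <= U)%MS & U *m p = U]) ->
  complemented s.
Proof.
move=> H U /H [p [hp pU Up]]; have pp : p *m p = p.
  by case/submxP: pU => D pD; rewrite {1}pD -mulmxA Up -pD.
exists (1%:M - p); split; [|split].
- by move=> r; rewrite mulmxBl mul1mx -hp -{1}[s r]mulmx1 -mulmxBr submxMl.
- apply/mxdirect_addsP/eqP/rowV0P => v; rewrite sub_capmx => /andP[/submxP[a va] /submxP[b vb]].
  have : v *m p = v by rewrite va -mulmxA Up.
  by rewrite {1}vb -mulmxA mulmxBl mul1mx pp subrr mulmx0.
- rewrite submx1 /= -{1}[1%:M](subrK p) addmx_sub ?addsmxSr //.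
  by rewrite (submx_trans pU) ?addsmxSl.
Qed.

(* A section of f on its image, corrected by projections, is an intertwiner. *)
Lemma hom_regular n m (s : R -> 'M[K]_n) (t : R -> 'M[K]_m) f :
  complemented s -> complemented t -> hom s t f ->
  exists2 h, hom t s h & f *m h *m f = f.
Proof.
move=> cs ct hf.
have kst r : stablemx (kermx f) (s r).
  by apply/sub_kermxP; rewrite -mulmxA hf mulmxA mulmx_ker mul0mx.
have [p0 [hp0 p0k kp0]] := complemented_proj cs kst.
pose q := 1%:M - p0.
have hq : hom s s q by apply: hom_add; [exact: hom_one|exact: hom_opp].
have p0f : p0 *m f = 0 by apply/sub_kermxP.
have qf : q *m f = f by rewrite mulmxBl mul1mx p0f subr0.
have qk k (v : 'M_(k, n)) : v *m f = 0 -> v *m q = 0.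
  move=> /eqP; rewrite -sub_kermx => /submxP[d ->].
  by rewrite -mulmxA mulmxBr mulmx1 kp0 subrr mulmx0.
have ist r : stablemx (<<f>>)%MS (t r).
  by rewrite (eqmxMr _ (genmxE f)) genmxE -hf submxMl.
have [p [hp pf fp]] := complemented_proj ct ist.
rewrite genmxE in pf.
have fpE : f *m p = f.
  have : (f <= <<f>>)%MS by rewrite genmxE.
  by case/submxP => d fd; rewrite {1}fd -mulmxA fp -fd.
(* [p] moves a vector into the image of [f], where [pinvmx f] picks some preimage; [q] kills the
   kernel of [f], so the choice of preimage does not matter. *)
pose h := p *m pinvmx f *m q.
have hE k (v : 'M_(k, m)) (w : 'M_(k, n)) : v *m p = w *m f -> v *m h = w *m q.
  move=> e; apply/eqP; rewrite -subr_eq0 /h mulmxA (mulmxA v) e -mulmxBl; apply/eqP/qk.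
  by rewrite mulmxBl mulmxKpV ?submxMl // subrr.
exists h.
  move=> r; case/submxP: pf => d pd.
  rewrite (hE _ _ (d *m s r)); last by rewrite hp -mulmxA hf pd mulmxA.
  rewrite -mulmxA hq mulmxA; congr (_ *m _).
  by rewrite -[h]mul1mx (hE _ _ d) // mul1mx.
by rewrite (hE _ _ 1%:M) ?mul1mx.
Qed.

(** [q *m i] is an idempotent commuting with the action; the new action is the one on the summand
    that it splits off, in coordinates of size [k]. *)
Lemma row_action_split n k (s : R -> 'M[K]_n) (i : 'M_(k, n)) (q : 'M_(n, k)) :
  i *m q = 1%:M -> hom s s (q *m i) -> row_action s ->
  row_action (fun r => i *m s r *m q).
Proof.
move=> iq he [s1 sD sM sZ]; split.
- by rewrite s1 mulmx1.
- by move=> x y; rewrite sD mulmxDr mulmxDl.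
- move=> x y; rewrite sM -!mulmxA; congr (_ *m _).
  by rewrite (mulmxA q i) (mulmxA (q *m i)) -he -!mulmxA iq mulmx1.
- by move=> c x; rewrite sZ -scalemxAr -scalemxAl.
Qed.

Lemma complemented_split n k (s : R -> 'M[K]_n) (i : 'M_(k, n)) (q : 'M_(n, k)) :
  i *m q = 1%:M -> hom s s (q *m i) -> complemented s ->
  complemented (fun r => i *m s r *m q).
Proof.
move=> iq he cs.
have is_ r : i *m s r *m (q *m i) = i *m s r.
  by rewrite -mulmxA he !mulmxA iq mul1mx.
have isq r : q *m i *m s r *m q = s r *m q by rewrite -he -!mulmxA iq mulmx1.
apply: proj_complemented => U Ust.
have Vst r : stablemx (<<U *m i>>)%MS (s r).
  rewrite (eqmxMr _ (genmxE _)) genmxE.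
  have -> : U *m i *m s r = U *m (i *m s r *m q) *m i.
    by rewrite -(mulmxA U (_ *m q)) -(mulmxA _ q i) is_ mulmxA.
  exact: submxMr.
have [p [hp pU Up]] := complemented_proj cs Vst; rewrite genmxE in pU.
have Uip : U *m i *m p = U *m i.
  have : (U *m i <= <<U *m i>>)%MS by rewrite genmxE.
  by case/submxP => d ud; rewrite {1}ud -mulmxA Up -ud.
exists (i *m p *m q); split.
- move=> r; rewrite !mulmxA -(mulmxA _ q i) is_ -(mulmxA i) hp.
  case/submxP: pU => d pd.
  have pqi : p *m q *m i = p by rewrite pd -!mulmxA (mulmxA i q i) iq mul1mx.
  by rewrite -(mulmxA i p q) -(mulmxA i _ i) pqi !mulmxA.
- rewrite (submx_trans (submxMr q (submxMl i p))) //.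
  by rewrite (submx_trans (submxMr q pU)) // -mulmxA iq mulmx1.
- by rewrite !mulmxA Uip -mulmxA iq mulmx1.
Qed.

Lemma row_action_block n m (s : R -> 'M[K]_n) (t : R -> 'M[K]_m) :
  row_action s -> row_action t -> row_action (fun r => block_mx (s r) 0 0 (t r)).
Proof.
move=> [s1 sD sM sZ] [t1 tD tM tZ]; split.
- by rewrite s1 t1 -scalar_mx_block.
- by move=> x y; rewrite sD tD add_block_mx !addr0.
- by move=> x y; rewrite sM tM mulmx_block !mulmx0 !mul0mx !addr0 !add0r.
- by move=> c x; rewrite sZ tZ scale_block_mx !scaler0.
Qed.

(** Let [U1] be the part of [U] inside the first summand and [U2] the projection of [U] to the
    second. Complements of [U1] and [U2] add up to a complement of [U], by a count of ranks. *)
Lemma complemented_block n m (s : R -> 'M[K]_n) (t : R -> 'M[K]_m) :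
  complemented s -> complemented t ->
  complemented (fun r => block_mx (s r) 0 0 (t r)).
Proof.
move=> cs ct U Ust; set b := fun r => block_mx (s r) 0 0 (t r).
pose p1 : 'M[K]_(n + m, n) := col_mx 1%:M 0.
pose p2 : 'M[K]_(n + m, m) := col_mx 0 1%:M.
pose i1 : 'M[K]_(n, n + m) := row_mx 1%:M 0.
pose i2 : 'M[K]_(m, n + m) := row_mx 0 1%:M.
have hp1 : hom b s p1 by move=> r; rewrite mul_block_col mul_col_mx !mulmx1 !mul1mx !mulmx0 !mul0mx !addr0.
have hp2 : hom b t p2 by move=> r; rewrite mul_block_col mul_col_mx !mulmx1 !mul1mx !mulmx0 !mul0mx !add0r.
have hi1 : hom s b i1 by move=> r; rewrite mul_row_block mul_mx_row !mulmx1 !mul1mx !mulmx0 !mul0mx !addr0.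
have hi2 : hom t b i2 by move=> r; rewrite mul_row_block mul_mx_row !mulmx1 !mul1mx !mulmx0 !mul0mx !add0r.
have ip1 : i1 *m p1 = 1%:M by rewrite mul_row_col mulmx1 mulmx0 addr0.
have ip2 : i2 *m p2 = 1%:M by rewrite mul_row_col mulmx1 mulmx0 add0r.
have i1p2 : i1 *m p2 = 0 by rewrite mul_row_col mul1mx mul0mx addr0.
have i2p1 : i2 *m p1 = 0 by rewrite mul_row_col mul1mx mul0mx addr0.
have pi : p1 *m i1 + p2 *m i2 = 1%:M.
  rewrite !mul_col_row !mul1mx ?mulmx0 ?mul0mx ?mulmx1 add_block_mx !addr0 !add0r.
  by rewrite -scalar_mx_block.
pose U1 := (<<(U :&: kermx p2)%MS *m p1>>)%MS; pose U2 := (<<U *m p2>>)%MS.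
have U2st r : stablemx U2 (t r).
  rewrite /U2 (eqmxMr _ (genmxE _)) genmxE -mulmxA -hp2 mulmxA.
  by apply/submxMr/Ust.
have U1st r : stablemx U1 (s r).
  rewrite /U1 (eqmxMr _ (genmxE _)) genmxE -mulmxA -hp1 mulmxA.
  apply/submxMr; rewrite sub_capmx (submx_trans (submxMr _ (capmxSl _ _))) ?Ust //=.
  rewrite sub_kermx -mulmxA hp2 mulmxA.
  by have /sub_kermxP-> := capmxSr U (kermx p2); rewrite mul0mx.
have [C1 [C1st [/mxdirect_addsP UC1 /andP[_ full1]]]] := cs _ U1st.
have [C2 [C2st [/mxdirect_addsP UC2 /andP[_ full2]]]] := ct _ U2st.
pose W := block_mx C1 0 0 C2; exists W.
have WE : W = col_mx (C1 *m i1) (C2 *m i2).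
  by rewrite /W !mul_mx_row !mulmx1 !mulmx0 block_mxEv.
have UW0 : (U :&: W)%MS = 0.
  apply/eqP/rowV0P => v; rewrite sub_capmx => /andP[vU].
  rewrite WE => /submxP[d]; rewrite -[d]hsubmxK mul_row_col !mulmxA.
  set c1 := _ *m C1; set c2 := _ *m C2 => vE.
  have vp2 : v *m p2 = c2 by rewrite vE mulmxDl -(mulmxA c1) -(mulmxA c2) ip2 i1p2 mulmx1 mulmx0 add0r.
  have c20 : c2 = 0.
    apply/eqP; rewrite -submx0 -UC2 sub_capmx submxMl genmxE -vp2 andbT.
    exact: submxMr.
  have vp1 : v *m p1 = c1 by rewrite vE mulmxDl -(mulmxA c1) -(mulmxA c2) ip1 i2p1 mulmx1 mulmx0 addr0.
  have c10 : c1 = 0.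
    apply/eqP; rewrite -submx0 -UC1 sub_capmx submxMl genmxE -vp1 andbT.
    by apply/submxMr; rewrite sub_capmx vU sub_kermx vp2 c20 eqxx.
  by rewrite vE c10 c20 !mul0mx addr0.
split=> [r|].
  rewrite WE mul_col_mx -!mulmxA -hi1 -hi2 !mulmxA.
  rewrite col_mx_sub -!addsmxE.
  rewrite (submx_trans (submxMr i1 (C1st r))) ?addsmxSl //=.
  by rewrite (submx_trans (submxMr i2 (C2st r))) ?addsmxSr.
split; first exact/mxdirect_addsP.
rewrite submx1 /=.
have i1r k (A : 'M[K]_(k, n)) : \rank (A *m i1) = \rank A.
  by apply/eqP; rewrite eqn_leq mxrankM_maxl /= -{1}[A]mulmx1 -ip1 mulmxA mxrankM_maxl.
have rU : (\rank U = \rank U1 + \rank U2)%N.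
  rewrite -(mxrank_mul_ker U p2) addnC /U1 /U2 !mxrank_gen; congr (_ + _)%N.
  set X := (U :&: _)%MS; rewrite -(i1r _ (X *m p1)) -mulmxA.
  have -> : X *m (p1 *m i1) = X; last by [].
  rewrite -{2}[X]mulmx1 -pi mulmxDr [X in _ + X]mulmxA.
  by have /sub_kermxP-> := capmxSr U (kermx p2); rewrite mul0mx addr0.
have r1 : (\rank U1 + \rank C1 = n)%N.
  by rewrite -mxrank_sum_cap UC1 mxrank0 addn0; apply/eqP;
    rewrite eqn_leq rank_leq_col -{1}(mxrank1 K n) mxrankS.
have r2 : (\rank U2 + \rank C2 = m)%N.
  by rewrite -mxrank_sum_cap UC2 mxrank0 addn0; apply/eqP;
    rewrite eqn_leq rank_leq_col -{1}(mxrank1 K m) mxrankS.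
have rW : (\rank W = \rank C1 + \rank C2)%N by rewrite rank_diag_block_mx.
rewrite sub1mx /row_full -(addn0 (\rank _)) -(mxrank0 K (n + m) (n + m)) -UW0.
by rewrite mxrank_sum_cap rU rW addnACA r1 r2.
Qed.

End RowActions.

(** * Separation of actions and rigidity of traces in characteristic 0 *)

Section TraceRigidity.
Variables (K : fieldType) (R : algType K).

(** Among the matrices whose row space lies in [V], one of maximal rank exhausts [V]: a vector
    outside could be adjoined. *)
Lemma subspace_mx n (V : 'rV[K]_n -> Prop) :
  V 0 -> (forall u v, V u -> V v -> V (u + v)) -> (forall c v, V v -> V (c *: v)) ->
  exists U : 'M[K]_n, forall v, (v <= U)%MS <-> V v.
Proof.
move=> V0 VD VZ; pose P k := `[< exists2 U : 'M[K]_n, forall v : 'rV_n, (v <= U)%MS -> V v & \rank U = k >].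
have exP : exists k, P k.
  exists 0%N; apply/asboolP; exists 0; last exact: mxrank0.
  by move=> v; rewrite submx0 => /eqP->.
have ubP k : P k -> (k <= n)%N by move=> /asboolP[U _ <-]; exact: rank_leq_row.
case: (ex_maxnP exP ubP) => k /asboolP[U UV rU] kmax; exists U => v; split; first exact: UV.
move=> Vv; apply: contraT => nvU; suff : P (\rank (U + v)%MS).
  by move/kmax; rewrite -rU leqNgt => /negP[]; apply: rank_ltmx;
    rewrite ltmxE addsmxSl addsmx_sub negb_and nvU orbT.
apply/asboolP; exists (U + v)%MS => // w /sub_addsmxP[[a b] /= ->].
apply: VD; first by apply: UV; exact: submxMl.
by rewrite [b]mx11_scalar mul_scalar_mx; exact: VZ.
Qed.

(** By regularity [f = f *m h *m f] with [h] going in the opposite direction, where everything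
    vanishes. *)
Lemma hom0_sym n m (s : R -> 'M[K]_n) (t : R -> 'M[K]_m) :
  complemented s -> complemented t ->
  (forall f, hom s t f -> f = 0) -> forall f, hom t s f -> f = 0.
Proof.
move=> cs ct h0 f hf; have [h hh <-] := hom_regular ct cs hf.
by rewrite (h0 _ hh) mulmx0 mul0mx.
Qed.

Lemma hom_blocks n m (s : R -> 'M[K]_n) (t : R -> 'M[K]_m) f :
  let b := fun r => block_mx (s r) 0 0 (t r) in
  hom b b f -> hom s t (ursubmx f) /\ hom t s (dlsubmx f).
Proof.
move=> b hf; split=> r; have := hf r; rewrite -{1 2}[f]submxK /b !mulmx_block;
  rewrite !mulmx0 !mul0mx ?addr0 ?add0r => /eq_block_mx[]; done.
Qed.

(** The orbit of [(v, w)] in the direct sum is stable, and an intertwining projection onto it is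
    block diagonal because no nonzero map joins [s] and [t]. It therefore fixes [(v, 0)], which thus
    lies in the orbit. *)
Lemma separate_vectors n m (s : R -> 'M[K]_n) (t : R -> 'M[K]_m) v w :
  row_action s -> row_action t -> complemented s -> complemented t ->
  (forall f, hom s t f -> f = 0) ->
  exists r, v *m s r = v :> 'rV_n /\ w *m t r = 0 :> 'rV_m.
Proof.
move=> [s1 sD sM sZ] [t1 tD tM tZ] cs ct h0.
pose V u := exists r, u = row_mx (v *m s r) (w *m t r).
have [|||U UV] := @subspace_mx (n + m) V.
- by exists 0; rewrite -(scale0r 1) sZ tZ !scale0r !mulmx0 row_mx0.
- by move=> _ _ [x ->] [y ->]; exists (x + y); rewrite sD tD !mulmxDr add_row_mx.
- by move=> c _ [x ->]; exists (c *: x); rewrite sZ tZ -!scalemxAr scale_row_mx.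
pose b r := block_mx (s r) 0 0 (t r).
have Ust r : stablemx U (b r).
  apply/row_subP => i; rewrite row_mul; have /UV[x ->] := row_sub i U.
  apply/UV; exists (r * x).
  by rewrite mul_row_block !mulmx0 addr0 add0r sM tM !mulmxA.
have [p [hp pU Up]] := complemented_proj (complemented_block cs ct) Ust.
have [h12 h21] := hom_blocks hp.
have z21 := hom0_sym cs ct h0 h21; have z12 := h0 _ h12.
have vwU : (row_mx v w <= U)%MS by apply/UV; exists 1; rewrite s1 t1 !mulmx1.
have vwp : row_mx v w *m p = row_mx v w by case/submxP: vwU => d ->; rewrite -mulmxA Up.
have v0p : row_mx v 0 *m p = row_mx v 0.
  move: vwp; rewrite -[p]submxK z12 z21 !mul_row_block !mulmx0 !addr0 !mul0mx.
  by rewrite !addr0 => /eq_row_mx[-> _].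
have /UV[r] : (row_mx v 0 <= U)%MS by rewrite -v0p (submx_trans (submxMl _ _)).
by case/eq_row_mx => e1 e2; exists r.
Qed.

Lemma row_action_dsum k n (M : 'I_k -> R -> 'M[K]_n) l :
  (forall i, row_action (M i)) -> row_action (dsum_rep M l).
Proof.
move=> aM; elim: l => [|i l IH] /=; last exact: row_action_block.
by split=> *; apply/matrixP => -[].
Qed.

Lemma complemented_dsum k n (M : 'I_k -> R -> 'M[K]_n) l :
  (forall i, complemented (M i)) -> complemented (dsum_rep M l).
Proof.
move=> aM; elim: l => [|i l IH] /=; last exact: complemented_block.
move=> U _; exists 0; split=> [r|]; first by rewrite mul0mx sub0mx.
split; first by apply/mxdirect_addsP; rewrite capmx0.
by rewrite submx1 /=; apply/row_subP => -[].
Qed.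

Lemma mxtrace_dsum k n (M : 'I_k -> R -> 'M[K]_n) l r :
  \tr (dsum_rep M l r) = \sum_(i <- l) \tr (M i r).
Proof.
elim: l => [|i l IH] /=; first by rewrite big_nil mxtrace0.
by rewrite big_cons -IH; exact: mxtrace_block.
Qed.

Lemma dsum_tr k n (M : 'I_k -> R -> 'M[K]_n) l r :
  (dsum_rep M l r)^T = dsum_rep (fun i x => (M i x)^T) l r.
Proof.
elim: l => [|i l IH] /=; first by rewrite trmx0.
by rewrite -IH; apply: etrans (tr_block_mx _ _ _ _) _; rewrite !trmx0.
Qed.

Lemma hom0_dsuml k n m (s : R -> 'M[K]_n) (t : R -> 'M[K]_m) (l : seq 'I_k) :
  (forall f, hom s t f -> f = 0) ->
  forall f, hom (dsum_rep (fun _ : 'I_k => s) l) t f -> f = 0.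
Proof.
move=> h0; elim: l => [|i l IH] /= f hf; first by apply/matrixP => -[].
have [fu [fd fE]] : exists (fu : 'M_(n, m)) (fd : 'M_(size l * n, m)), f = col_mx fu fd.
  by exists (usubmx (f : 'M_(n + size l * n, m))), (dsubmx (f : 'M_(n + size l * n, m)));
     rewrite vsubmxK.
have hud r : s r *m fu = fu *m t r /\ dsum_rep (fun _ : 'I_k => s) l r *m fd = fd *m t r.
  have := hf r; rewrite fE mul_block_col mul_col_mx !mul0mx addr0 add0r.
  by case/eq_col_mx.
have fu0 : fu = 0 by apply: h0 => r; case: (hud r).
have fd0 : fd = 0 by apply: IH => r; case: (hud r).
rewrite fE fu0 fd0; exact: col_mx0.
Qed.

(** For [A = 1] and [l] the full enumeration, the image of this vector under copies of [s r] records
    the whole matrix [s r]. *)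
Fixpoint stack k n (A : 'M[K]_(k, n)) (l : seq 'I_k) : 'rV[K]_(size l * n) :=
  match l with
  | [::] => 0
  | i :: l' => row_mx (row i A) (stack A l')
  end.

Lemma stack_mul k n (A : 'M[K]_(k, n)) (s : R -> 'M[K]_n) l r :
  stack A l *m dsum_rep (fun _ : 'I_k => s) l r = stack (A *m s r) l.
Proof.
elim: l => [|i l IH] /=; first by rewrite mulmx0.
by rewrite -IH row_mul; rewrite mul_row_block !mulmx0 addr0 add0r.
Qed.

Lemma stack0 k n (l : seq 'I_k) : stack (0 : 'M[K]_(k, n)) l = 0.
Proof. by elim: l => //= i l ->; rewrite row0 row_mx0. Qed.

Lemma stack_inj k n (A B : 'M[K]_(k, n)) l :
  stack A l = stack B l -> forall i, i \in l -> row i A = row i B.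
Proof.
elim: l => //= j l IH /eq_row_mx[eAB /IH eqAB] i.
by rewrite inE => /orP[/eqP-> //|/eqAB].
Qed.

(** The density argument: separating two vectors in sums of copies of [s] and [t], namely the
    stacked standard bases, separates the matrices themselves. *)
Lemma separate_actions n m (s : R -> 'M[K]_n) (t : R -> 'M[K]_m) :
  row_action s -> row_action t -> complemented s -> complemented t ->
  (forall f, hom s t f -> f = 0) -> exists r, s r = 1%:M /\ t r = 0.
Proof.
move=> as_ at_ cs ct h0.
pose S := dsum_rep (fun _ : 'I_n => s) (enum 'I_n).
pose T := dsum_rep (fun _ : 'I_m => t) (enum 'I_m).
have cS : complemented S by apply: complemented_dsum.
have cT : complemented T by apply: complemented_dsum.
have h1 f : hom S T f -> f = 0.
  apply: (hom0_sym cT cS); apply: hom0_dsuml.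
  by apply: (hom0_sym cS ct); apply: hom0_dsuml.
have [r []] := separate_vectors (stack 1%:M _) (stack 1%:M _)
  (row_action_dsum _ (fun=> as_)) (row_action_dsum _ (fun=> at_)) cS cT h1.
rewrite !stack_mul !mul1mx -(stack0 m) => /stack_inj e1 /stack_inj e2.
by exists r; split; apply/row_matrixP => i; rewrite ?e1 ?e2 ?mem_enum.
Qed.

Lemma idempotent_factor n (u : 'M[K]_n) : u *m u = u ->
  exists k (c : 'M_(n, k)) (b : 'M_(k, n)), [/\ \rank u = k, c *m b = u & b *m c = 1%:M].
Proof.
move=> uu; exists (\rank u), (col_base u), (row_base u); split=> //; first exact: mulmx_base.
apply: (row_free_inj (row_base_free u)); rewrite mul1mx.
apply: (row_full_inj (col_base_full u)).
by rewrite mulmx_base -(mulmxA (row_base u)) mulmx_base mulmxA mulmx_base.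
Qed.

Hypothesis char0 : [pchar K] =i pred0.

(** The trace of an idempotent is its rank, read in [K]. *)
Lemma idempotent_trace0 n (u : 'M[K]_n) : u *m u = u -> \tr u = 0 -> u = 0.
Proof.
move=> /idempotent_factor[k [c [b [rk cb bc]]]].
rewrite -cb mxtrace_mulC bc mxtrace1 => /eqP; rewrite ((pcharf0P K).1 char0) => /eqP k0.
by apply/eqP; rewrite cb -mxrank_eq0 rk k0.
Qed.

(* The Bezout idempotent of ('X - 1)^m and its cofactor has no constant term, so its
   trace is a combination of the \tr (A ^+ i.+1); it would be nonzero were 1 an eigenvalue. *)
Lemma power_traces0 n (A : 'M[K]_n.+1) (v : 'rV_n.+1) :
  (forall i, \tr (A ^+ i.+1) = 0) -> v *m A = v -> v = 0.
Proof.
move=> tr0 vA; apply/eqP; apply: contraT => v0.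
have r1 : root (char_poly A) 1.
  by rewrite -eigenvalue_root_char; apply/eigenvalueP; exists v; rewrite ?scale1r.
have [m [g]] := multiplicity_XsubC (char_poly A) 1.
rewrite monic_neq0 ?char_poly_monic //= => g1 pE.
have m0 : (0 < m)%N.
  by rewrite lt0n; apply: contraL r1 => /eqP m0; rewrite pE m0 expr0 mulr1.
have cop : coprimep (('X - 1%:P) ^+ m) ('X * g).
  rewrite coprimep_expl // coprimep_sym coprimep_XsubC /root hornerM hornerX mul1r; exact: g1.
have [[w1 w2] /= /eqpP[[c1 c2] /= /andP[c10 c20]] e] := Bezout_coprimepP _ _ cop.
have {}e : c1 *: (w1 * ('X - 1%:P) ^+ m + w2 * ('X * g)) = c2%:P.
  by rewrite e; rewrite -mul_polyC mulr1.
pose d := c2^-1 * c1.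
pose E := d *: (w2 * ('X * g)).
have E1 : 1 - E = d *: w1 * ('X - 1%:P) ^+ m.
  apply/eqP; rewrite subr_eq /E -scalerAl -scalerDr /d -scalerA e.
  by rewrite -mul_polyC -polyCM mulVf.
have EE : horner_mx A E * (1 - horner_mx A E) = 0.
  rewrite -(rmorph1 (horner_mx A)) -rmorphB -rmorphM /= E1 /E.
  have -> : d *: (w2 * ('X * g)) * (d *: w1 * ('X - 1%:P) ^+ m)
      = d *: w2 * 'X * (d *: w1) * (g * ('X - 1%:P) ^+ m).
    by rewrite -!mul_polyC; ring.
  by rewrite -pE rmorphM /= Cayley_Hamilton mulr0.
have trX q : \tr (horner_mx A (q * 'X)) = 0.
  rewrite rmorphM /= horner_mx_X -[q]coefK poly_def linear_sum /= mulr_suml raddf_sum big1 //= => i _.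
  by rewrite horner_mxZ rmorphXn /= horner_mx_X -scalerAl -exprSr linearZ /= tr0 mulr0.
have E0 : horner_mx A E = 0.
  apply: idempotent_trace0.
    by apply/esym/eqP; rewrite -subr_eq0 -[X in X - _]mulmx1 -mulmxBr; apply/eqP.
  have -> : E = d *: (w2 * g) * 'X by rewrite /E -!mul_polyC; ring.
  exact: trX.
(* A vector fixed by [A] is scaled by [q.[1]] under any polynomial [q] in [A]. As [1 - E] is a
   multiple of a positive power of ['X - 1], [E.[1] = 1], while [E] vanishes at [A]. *)
have vq q : v *m horner_mx A q = q.[1] *: v.
  rewrite -[q in LHS]coefK poly_def linear_sum /= mulmx_sumr horner_coef scaler_suml.
  apply: eq_bigr => i _; rewrite horner_mxZ rmorphXn /= horner_mx_X -scalemxAr expr1n mulr1.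
  congr (_ *: _); elim: (i : nat) => [|k IH]; first by rewrite expr0 mulmx1.
  by rewrite exprSr mulmxA IH.
have : E.[1] = 1.
  have : (1 - E).[1] = 0.
    by rewrite E1 hornerM horner_exp hornerXsubC subrr expr0n eqn0Ngt m0 mulr0.
  by rewrite hornerD hornerN hornerC => /eqP; rewrite subr_eq0 => /eqP.
by move=> E11; have := vq E; rewrite E0 mulmx0 E11 scale1r => /esym/eqP; rewrite (negPf v0).
Qed.

(** Otherwise some [r] acts as 1 through [s] and as 0 through [t], and the equality of traces reads
    [n = 0] in [K]. *)
Lemma mxtrace_hom n m (s : R -> 'M[K]_n) (t : R -> 'M[K]_m) :
  row_action s -> row_action t -> complemented s -> complemented t ->
  (forall r, \tr (s r) = \tr (t r)) -> (0 < n)%N -> exists2 f, hom s t f & f != 0.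
Proof.
move=> as_ at_ cs ct est n0; apply: contrapT => h0.
have [f hf|r [s1 t0]] := separate_actions as_ at_ cs ct.
  by apply/eqP; apply: contraT => f0; case: h0; exists f.
have := est r; rewrite s1 t0 mxtrace1 mxtrace0 => /eqP.
by rewrite ((pcharf0P K).1 char0) eqn0Ngt n0.
Qed.

(** Take an intertwiner [f] of maximal rank and cut both actions down to the summands that [f]
    misses, through the idempotents [e] and [e']. Their traces still agree, so if [f] were not
    invertible, a nonzero map between them could be added to [f]. *)
Lemma mxtrace_iso n (s t : R -> 'M[K]_n) :
  row_action s -> row_action t -> complemented s -> complemented t ->
  (forall r, \tr (s r) = \tr (t r)) -> exists2 f, hom s t f & f \in unitmx.
Proof.
move=> as_ at_ cs ct est.
pose P k := `[< exists2 f, hom s t f & \rank f = k >].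
have exP : exists k, P k.
  exists 0%N; apply/asboolP; exists 0; last exact: mxrank0.
  by move=> r; rewrite mulmx0 mul0mx.
have ubP k : P k -> (k <= n)%N by move=> /asboolP[U _ <-]; exact: rank_leq_row.
case: (ex_maxnP exP ubP) => k /asboolP[f hf rf] kmax.
have [h hh fhf] := hom_regular cs ct hf.
pose e := 1%:M - f *m h; pose e' := 1%:M - h *m f.
have he : hom s s e by apply: hom_add; [exact: hom_one|apply: hom_opp; exact: hom_mul hf hh].
have he' : hom t t e' by apply: hom_add; [exact: hom_one|apply: hom_opp; exact: hom_mul hh hf].
have ef : e *m f = 0 by rewrite mulmxBl mul1mx fhf subrr.
have fe' : f *m e' = 0 by rewrite mulmxBr mulmx1 mulmxA fhf subrr.
have ee : e *m e = e by rewrite {2}/e mulmxBr mulmx1 mulmxA ef mul0mx subr0.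
have e'e' : e' *m e' = e' by rewrite {1}/e' mulmxBl mul1mx -mulmxA fe' mulmx0 subr0.
have [r0|rpos] := posnP (\rank e).
  exists f => //; move/eqP: r0; rewrite mxrank_eq0 subr_eq0 => /eqP/esym/mulmx1_unit.
  by case.
have [l [c [b [el cb bc]]]] := idempotent_factor ee; rewrite el in rpos.
have [l' [c' [b' [_ cb' bc']]]] := idempotent_factor e'e'.
pose s' r := b *m s r *m c.
pose t' r := b' *m t r *m c'.
rewrite -cb in he; rewrite -cb' in he'.
have [| |||r|//|g hg g0] := @mxtrace_hom _ _ s' t'.
- exact: row_action_split.
- exact: row_action_split.
- exact: complemented_split.
- exact: complemented_split.
- have trb d (u : 'M[K]_(d, n)) v (A : 'M[K]_n) : \tr (u *m A *m v) = \tr (A *m (v *m u)).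
    by rewrite -mulmxA mxtrace_mulC -mulmxA.
  rewrite !trb cb cb' !mulmxBr !mulmx1 !raddfB /= est; congr (_ - _).
  by rewrite mulmxA hf -mulmxA mxtrace_mulC -mulmxA.
pose G := c *m g *m b'.
have hG : hom s t G.
  move=> r; rewrite /G !mulmxA.
  have sc : s r *m c = c *m s' r.
    by rewrite /s' mulmxA (mulmxA c) -he -!mulmxA bc mulmx1.
  have tb : t' r *m b' = b' *m t r.
    by rewrite /t' -(mulmxA _ c') -(mulmxA b') he' !mulmxA bc' mul1mx.
  by rewrite sc -(mulmxA c) hg -(mulmxA c (g *m _)) -(mulmxA g) tb !mulmxA.
have eG : e *m G = G.
  by rewrite /G -cb -!mulmxA (mulmxA b c) bc mul1mx.
have Ge' : G *m e' = G.
  by rewrite /G -cb' -!mulmxA (mulmxA b' c') bc' mul1mx.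
have G0 : G != 0.
  apply: contraNneq g0 => G0; apply/eqP.
  have := congr1 (fun X => b *m X *m c') G0.
  by rewrite /G !mulmxA bc mul1mx -mulmxA bc' mulmx1 mulmx0 mul0mx.
have Ghf : G *m (h *m f) = 0.
  rewrite -Ge' -mulmxA mulmxBl mul1mx.
  have -> : h *m f *m (h *m f) = h *m f by rewrite -[in RHS]fhf !mulmxA.
  by rewrite subrr mulmx0.
(* The image of [f + G] under [h *m f] is that of [f], and the kernel of this map contains
   [e *m (f + G) = G], which is nonzero; so the rank has increased. *)
suff : P (\rank (f + G)%R).
  move/kmax; rewrite -rf leqNgt => /negP[].
  rewrite -(mxrank_mul_ker (f + G) (h *m f)) mulmxDl Ghf addr0 mulmxA fhf.
  rewrite -{1}(addn0 (\rank f)) ltn_add2l lt0n mxrank_eq0.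
  apply: contraNneq G0 => X0; rewrite -submx0 -X0 sub_capmx sub_kermx Ghf eqxx andbT.
  by rewrite -{1}eG -(add0r (e *m G)) -ef -mulmxDr submxMl.
by apply/asboolP; exists (f + G) => //; apply: hom_add.
Qed.

End TraceRigidity.

(** * Coordinates and characteristic polynomials over a central subalgebra *)

(** The bundle lets the subalgebra be a type with a canonical integral domain structure, hence with
    a fraction field. Primality enters because it makes nonzero central elements regular in [R]. *)
Record central_subalg (K : fieldType) (R : algType K) := CentralSubalg {
  subalg_pred :> R -> Prop;
  subalg_predP : is_subalg subalg_pred;
  subalg_central : forall x, subalg_pred x -> central x;
  subalg_prime : prime_ring R }.

Section CentralSubalg.
Variables (K : fieldType) (R : algType K) (S : central_subalg R).

Lemma subalg1 : S 1. Proof. by case: (subalg_predP S). Qed.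
Lemma subalgD x y : S x -> S y -> S (x + y).
Proof. by case: (subalg_predP S) => _ + _ _; exact. Qed.
Lemma subalgM x y : S x -> S y -> S (x * y).
Proof. by case: (subalg_predP S) => _ _ + _; exact. Qed.
Lemma subalgZ c x : S x -> S (c *: x).
Proof. by case: (subalg_predP S) => _ _ _; exact. Qed.
Lemma subalg0 : S 0. Proof. by rewrite -(scale0r 1); exact/subalgZ/subalg1. Qed.
Lemma subalgN x : S x -> S (- x). Proof. by rewrite -scaleN1r; exact: subalgZ. Qed.
Lemma subalg_sum I (r : seq I) (P : pred I) (F : I -> R) :
  (forall i, P i -> S (F i)) -> S (\sum_(i <- r | P i) F i).
Proof. by move=> h; elim/big_ind: _ => //; [exact: subalg0|exact: subalgD]. Qed.

Definition subalg_mem : {pred R} := fun x => `[< S x >].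

Fact subalg_mem_subring : subring_closed subalg_mem.
Proof.
split; rewrite /in_mem /=; first by apply/asboolP; exact: subalg1.
  by move=> x y /asboolP Sx /asboolP Sy; apply/asboolP/subalgD => //; exact: subalgN.
by move=> x y /asboolP Sx /asboolP Sy; apply/asboolP/subalgM.
Qed.
HB.instance Definition _ := GRing.isSubringClosed.Build R subalg_mem subalg_mem_subring.

Record subalg_type := SubalgElt { subalg_val :> R; _ : subalg_val \in subalg_mem }.
HB.instance Definition _ := [isSub for subalg_val].
HB.instance Definition _ := [Choice of subalg_type by <:].
HB.instance Definition _ := [SubChoice_isSubNzRing of subalg_type by <:].

Fact subalg_val_zmod : zmod_morphism subalg_val.
Proof. exact: (raddfB (val : subalg_type -> R)). Qed.
Fact subalg_val_monoid : monoid_morphism subalg_val.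
Proof. by split; [exact: (rmorph1 (val : subalg_type -> R))|exact: (rmorphM (val : subalg_type -> R))]. Qed.
HB.instance Definition _ := GRing.isZmodMorphism.Build subalg_type R subalg_val subalg_val_zmod.
HB.instance Definition _ := GRing.isMonoidMorphism.Build subalg_type R subalg_val subalg_val_monoid.

Lemma subalg_val_inj : injective subalg_val. Proof. exact: val_inj. Qed.

Lemma subalg_valP (x : subalg_type) : S (subalg_val x).
Proof. by apply/asboolP; exact: (valP x). Qed.

Fact subalg_mulC : commutative (@GRing.mul subalg_type).
Proof. by move=> x y; apply: subalg_val_inj; apply: (subalg_central (subalg_valP x)). Qed.
HB.instance Definition _ := GRing.PzRing_hasCommutativeMul.Build subalg_type subalg_mulC.

Lemma central_domain (x y : R) : central x -> x * y = 0 -> x = 0 \/ y = 0.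
Proof.
move=> cx xy; apply: (subalg_prime S) => r.
by rewrite cx -mulrA xy mulr0.
Qed.

Fact subalg_integral (x y : subalg_type) : x * y = 0 -> (x == 0) || (y == 0).
Proof.
move=> /(congr1 subalg_val); rewrite rmorphM rmorph0 => xy.
have [x0|y0] := central_domain (subalg_central (subalg_valP x)) xy; apply/orP.
  by left; apply/eqP/subalg_val_inj; rewrite x0 rmorph0.
by right; apply/eqP/subalg_val_inj; rewrite y0 rmorph0.
Qed.

(** Units and inverses come from classical choice: the subalgebra is an arbitrary predicate, but the
    interface of integral domains asks for an inverse function. *)
Definition subalg_unit : pred subalg_type := fun x => `[< exists y, y * x = 1 >].
Definition subalg_inv (x : subalg_type) : subalg_type :=
  if pselect (exists y, y * x = 1) is left h then projT1 (cid h) else x.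
Fact subalg_mulV : {in subalg_unit, left_inverse 1 subalg_inv *%R}.
Proof.
move=> x /asboolP ux; rewrite /subalg_inv; case: pselect => // h.
by case: (cid h).
Qed.
Fact subalg_unitP (x y : subalg_type) : y * x = 1 -> subalg_unit x.
Proof. by move=> e; apply/asboolP; exists y. Qed.
Fact subalg_inv_out : {in [predC subalg_unit], subalg_inv =1 id}.
Proof.
by move=> x /asboolP ux; rewrite /subalg_inv; case: pselect.
Qed.
HB.instance Definition _ :=
  GRing.ComNzRing_hasMulInverse.Build subalg_type subalg_mulV subalg_unitP subalg_inv_out.
HB.instance Definition _ := GRing.ComUnitRing_isIntegral.Build subalg_type subalg_integral.

Lemma subalg_elt (x : R) : S x -> exists y : subalg_type, subalg_val y = x.
Proof.
move=> Sx; have Sx' : x \in subalg_mem by apply/asboolP.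
by exists (SubalgElt Sx').
Qed.

End CentralSubalg.
Arguments subalg_val {K R S} _ : simpl never.

(** * Fractions and determinants *)

Section Fractions.
Variable T : idomainType.
Local Notation "x %:F" := (FracField.tofrac x).

Lemma frac_repr (u : {fraction T}) : exists a b : T, b != 0 /\ u = a%:F / b%:F.
Proof.
elim/quotW: u => x; exists (\n_x)%R, (\d_x)%R; split; first exact: denom_ratioP.
have d0 := denom_ratioP x.
rewrite -{1}[x]Ratio_numden; apply: (canRL (mulfK _)); first by rewrite tofrac_eq0.
unlock FracField.tofrac; rewrite [LHS](esym (FracField.pi_mul _ _)); apply/eqmodP => /=.
by rewrite FracField.equivfE /FracField.mulf !numden_Ratio ?mulr1 ?mul1r ?oner_neq0 // mulrC.
Qed.

Lemma tofrac_inj : injective (@FracField.tofrac T).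
Proof. by move=> u v /eqP; rewrite tofrac_eq => /eqP. Qed.

Lemma frac_common n (u : 'I_n -> {fraction T}) :
  exists d : T, d != 0 /\ exists b : 'I_n -> T, forall i, d%:F * u i = (b i)%:F.
Proof.
have h i : exists ab : T * T, ab.2 != 0 /\ u i = ab.1%:F / ab.2%:F.
  by have [a [b ?]] := frac_repr (u i); exists (a, b).
have [f fP] := choice h; exists (\prod_i (f i).2); split.
  by apply/prodf_neq0 => i _; case: (fP i).
exists (fun i => (f i).1 * \prod_(j | j != i) (f j).2) => i.
have [b0 ->] := fP i; rewrite (bigD1 i) //= !rmorphM /= mulrAC mulrCA.
by rewrite mulfV ?mulr1 ?tofrac_eq0 // mulrC.
Qed.

(** The relation says that [D] is an eigenvector of the matrix [t] for the eigenvalue [u]. An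
    arbitrary finite index type is allowed because [D] will be a vector of minors indexed by
    maps. *)
Lemma eigen_root (I : finType) (D : I -> {fraction T}) u (t : I -> I -> T) i0 :
  D i0 != 0 -> (forall i, u * D i = \sum_j (t i j)%:F * D j) ->
  root (map_poly (@FracField.tofrac T)
    (char_poly (\matrix_(i < #|I|, j < #|I|) t (enum_val i) (enum_val j)))) u.
Proof.
move=> D0 h; rewrite map_char_poly; set A := map_mx _ _.
have -> : char_poly A = char_poly A^T.
  apply: etrans (esym (det_tr _)) _; congr (\det _).
  by rewrite /char_poly_mx linearB /= tr_scalar_mx map_trmx.
rewrite -eigenvalue_root_char.
apply/eigenvalueP; exists (\row_i D (enum_val i)).
  apply/rowP => i; rewrite !mxE h [RHS](reindex (@enum_val _ predT)) /=; last first.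
    by apply/onW_bij/enum_val_bij.
  by apply: eq_bigr => j _; rewrite !mxE mulrC.
apply: contraNneq D0 => /rowP/(_ (enum_rank i0)).
by rewrite !mxE enum_rankK => ->.
Qed.

End Fractions.

(** Multilinear expansion in the rows of the product. Summing over all maps, not only over
    increasing ones as in the Cauchy-Binet formula, leaves products of entries of [A] instead of
    minors. *)
Lemma det_mulmx_rect (F : comNzRingType) n m (A : 'M[F]_(n, m)) (G : 'M[F]_(m, n)) :
  \det (A *m G) =
  \sum_(f : {ffun 'I_n -> 'I_m}) \prod_i A i (f i) * \det (rowsub f G).
Proof.
pose AB (s : 'S_n) i j := A i j * G j (s i).
transitivity (\sum_(f : {ffun 'I_n -> 'I_m}) \sum_(s : 'S_n) (-1) ^+ s * \prod_i AB s i (f i)).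
  rewrite exchange_big; apply: eq_bigr => /= s _; rewrite -big_distrr /=.
  congr (_ * _); rewrite -(bigA_distr_bigA (AB s)) /=.
  by apply: eq_bigr => x _; rewrite mxE.
apply: eq_bigr => f _; rewrite big_distrr /=; apply: eq_bigr => s _.
rewrite mulrCA big_split //=; congr (_ * (_ * _)).
by apply: eq_bigr => x _; rewrite mxE.
Qed.

(** * Coordinates and multiplication matrices over the fraction field *)

Section Coordinates.
Variables (K : fieldType) (R : algType K) (S : central_subalg R) (M : R -> Prop).
Local Notation T := (subalg_type S).
Local Notation F := {fraction T}.
Local Notation "x %:F" := (@FracField.tofrac T x).
Hypothesis (M_subalg : is_subalg M) (subM : forall x, S x -> M x).

Lemma overalg_sum I (r : seq I) (P : pred I) (f : I -> R) :
  (forall i, P i -> M (f i)) -> M (\sum_(i <- r | P i) f i).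
Proof.
case: M_subalg => _ MD _ _ h; elim/big_ind: _ => //.
exact/subM/subalg0.
Qed.

Lemma overalg_mul x y : M x -> M y -> M (x * y).
Proof. by case: M_subalg => _ _ + _; exact. Qed.

Lemma overalg_smul (s : T) y : M y -> M (subalg_val s * y).
Proof. by apply: overalg_mul; apply/subM/subalg_valP. Qed.

Lemma val_mul_eq0 (s : T) y : s != 0 -> subalg_val s * y = 0 -> y = 0.
Proof.
move=> s0 /(central_domain S (subalg_central (subalg_valP s)))[] // e.
by case/eqP: s0; apply: subalg_val_inj; rewrite e rmorph0.
Qed.

Lemma valC (s : T) y : subalg_val s * y = y * subalg_val s.
Proof. exact: (subalg_central (subalg_valP s)). Qed.

Lemma subalg_family (I : Type) (f : I -> R) : (forall i, S (f i)) ->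
  exists g : I -> T, forall i, subalg_val (g i) = f i.
Proof. by move=> h; have [g gP] := choice (fun i => subalg_elt (h i)); exists g. Qed.

Lemma indepE n (x : 'I_n -> R) : indep S x <->
  forall c : 'I_n -> T, \sum_i subalg_val (c i) * x i = 0 -> forall i, c i = 0.
Proof.
split=> [h c e i|h c cS].
  apply: subalg_val_inj; rewrite rmorph0.
  by apply: (h (fun i => subalg_val (c i))) => // j; exact: subalg_valP.
have [g gP] := subalg_family cS => e i.
rewrite -gP h ?rmorph0 // -[RHS]e; apply: eq_bigr => j _; by rewrite gP.
Qed.

(** A basis over the fraction field [F] of the localized module, chosen inside [M]: spanning is
    asked up to a nonzero denominator. *)
Definition is_basis n (x : 'I_n -> R) : Prop :=
  [/\ forall i, M (x i), indep S x &
      forall y, M y -> exists c : T, c != 0 /\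
        exists al : 'I_n -> T, subalg_val c * y = \sum_i subalg_val (al i) * x i].

Section Basis.
Variables (n : nat) (x : 'I_n -> R).
Hypothesis xB : is_basis x.

(** Coordinates in the localization of [M], expressed without constructing it: [c] is a common
    denominator. *)
Definition has_coord (y : R) (v : 'rV[F]_n) : Prop :=
  exists c : T, c != 0 /\ exists al : 'I_n -> T,
    subalg_val c * y = \sum_i subalg_val (al i) * x i /\ forall i, c%:F * v 0 i = (al i)%:F.

Lemma has_coord_uniq y v w : has_coord y v -> has_coord y w -> v = w.
Proof.
case: xB => _ /indepE xi _ [c [c0 [al [ce cv]]]] [d [d0 [be [de dw]]]].
have h i : d * al i = c * be i.
  apply/eqP; rewrite -subr_eq0; apply/eqP; move: i.
  apply: xi; transitivity (subalg_val d * (subalg_val c * y) - subalg_val c * (subalg_val d * y)).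
    rewrite ce de !mulr_sumr -sumrB; apply: eq_bigr => i _.
    by rewrite rmorphB !rmorphM /= mulrBl !mulrA.
  by rewrite !mulrA (valC d) subrr.
apply/rowP => i; have cd0 : c%:F * d%:F != 0 by rewrite mulf_neq0 ?tofrac_eq0.
apply: (mulfI cd0); rewrite -[RHS]mulrA dw mulrAC cv -!rmorphM /= mulrC h //.
Qed.

Lemma has_coordD y z v w : has_coord y v -> has_coord z w -> has_coord (y + z) (v + w).
Proof.
move=> [c [c0 [al [ce cv]]]] [d [d0 [be [de dw]]]].
exists (c * d); split; first exact: mulf_neq0.
exists (fun i => d * al i + c * be i); split=> [|i].
  rewrite mulrDr rmorphM /= {1}(valC c) -!mulrA ce de !mulr_sumr -big_split.
  by apply: eq_bigr => i _ /=; rewrite rmorphD !rmorphM /= mulrDl !mulrA.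
by rewrite mxE mulrDr !rmorphD !rmorphM /= -cv -dw; congr (_ + _); rewrite !mulrA // (mulrC d%:F).
Qed.

Lemma has_coordZ (s : T) y v : has_coord y v -> has_coord (subalg_val s * y) (s%:F *: v).
Proof.
move=> [c [c0 [al [ce cv]]]]; exists c; split=> //.
exists (fun i => s * al i); split=> [|i].
  rewrite mulrA (valC c) -mulrA ce mulr_sumr.
  by apply: eq_bigr => i _; rewrite rmorphM /= mulrA.
by rewrite mxE mulrCA cv rmorphM.
Qed.

Lemma has_coord_ex y : M y -> exists v, has_coord y v.
Proof.
case: xB => _ _ h /h[c [c0 [al e]]]; exists (\row_i ((al i)%:F / c%:F)).
exists c; split=> //; exists al; split=> // i.
by rewrite mxE mulrCA mulfV ?mulr1 ?tofrac_eq0.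
Qed.

Definition fcoord (y : R) : 'rV[F]_n :=
  if pselect (exists v, has_coord y v) is left h then projT1 (cid h) else 0.

Lemma fcoordP y : M y -> has_coord y (fcoord y).
Proof.
by move=> /has_coord_ex h; rewrite /fcoord; case: pselect => // h'; case: (cid h').
Qed.

Lemma fcoordE y v : M y -> has_coord y v -> fcoord y = v.
Proof. by move=> /fcoordP; exact: has_coord_uniq. Qed.

Lemma fcoordD y z : M y -> M z -> fcoord (y + z) = fcoord y + fcoord z.
Proof.
move=> My Mz; apply: fcoordE; last by apply: has_coordD; exact: fcoordP.
by case: M_subalg => _ MD _ _; exact: MD.
Qed.

Lemma fcoordZ (s : T) y : M y -> fcoord (subalg_val s * y) = s%:F *: fcoord y.
Proof.
by move=> My; apply: fcoordE; [exact: overalg_smul|apply/has_coordZ/fcoordP].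
Qed.

Lemma fcoord0 : fcoord 0 = 0.
Proof.
have M0 : M 0 by apply/subM/subalg0.
by rewrite -(mul0r 0) -(rmorph0 (subalg_val : T -> R)) fcoordZ // tofrac0 scale0r.
Qed.

Lemma fcoord_sum I (r : seq I) (f : I -> R) (c : I -> T) : (forall i, M (f i)) ->
  fcoord (\sum_(i <- r) subalg_val (c i) * f i) = \sum_(i <- r) (c i)%:F *: fcoord (f i).
Proof.
move=> h; elim: r => [|i r IH]; first by rewrite !big_nil fcoord0.
rewrite !big_cons fcoordD ?IH ?fcoordZ //; first exact: overalg_smul.
by apply: overalg_sum => j _; exact: overalg_smul.
Qed.

Lemma fcoord_inj y : M y -> fcoord y = 0 -> y = 0.
Proof.
move=> My y0; have [c [c0 [al [e h]]]] := fcoordP My.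
apply: (val_mul_eq0 c0); rewrite e big1 // => i _.
move: (h i); rewrite y0 mxE mulr0 => /esym/eqP; rewrite tofrac_eq0 => /eqP->.
by rewrite rmorph0 mul0r.
Qed.

Lemma fcoord_eq y y' : M y -> M y' -> fcoord y = fcoord y' -> y = y'.
Proof.
move=> My My' e; apply/eqP; rewrite -subr_eq0; apply/eqP; have Ny' := overalg_smul (-1) My'.
have y'E : subalg_val (-1 : T) * y' = - y' by rewrite rmorphN rmorph1 mulN1r.
rewrite y'E in Ny'; apply: fcoord_inj; first by case: M_subalg => _ MD _ _; exact: MD.
by rewrite fcoordD // -y'E fcoordZ // e tofracN tofrac1 scaleN1r subrr.
Qed.

Lemma fcoord_basis i : fcoord (x i) = delta_mx 0 i.
Proof.
have [Mx _ _] := xB; apply: fcoordE => //; exists 1; split; first exact: oner_neq0.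
exists (fun j => (j == i)%:R); split=> [|j].
  rewrite rmorph1 mul1r (bigD1 i) //= eqxx rmorph1 mul1r big1 ?addr0 // => j /negPf->.
  by rewrite rmorph0 mul0r.
by rewrite tofrac1 mul1r mxE eqxx /= rmorph_nat.
Qed.

(** A linear relation over [F] becomes one over the subalgebra after multiplication by a common
    denominator. *)
Lemma indep_row_free m (y : 'I_m -> R) : (forall j, M (y j)) ->
  indep S y <-> row_free (\matrix_j fcoord (y j)).
Proof.
move=> My; split=> [/indepE yi|yf].
  apply: inj_row_free => u /rowP u0.
  have [d [d0 [b ub]]] := frac_common (fun j => u 0 j).
  have b0 j : b j = 0.
    move: j; apply: yi; apply: fcoord_inj; first by apply: overalg_sum => i _; exact: overalg_smul.
    rewrite fcoord_sum //; apply/rowP => k.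
    have := u0 k; rewrite !mxE summxE => /(congr1 (GRing.mul d%:F)).
    rewrite mulr0 mulr_sumr => e; rewrite -[RHS]e; apply: eq_bigr => j _.
    by rewrite !mxE -ub mulrA.
  apply/rowP => j; rewrite mxE; apply: (mulfI (x := d%:F)); first by rewrite tofrac_eq0.
  by rewrite ub b0 mulr0 tofrac0.
apply/indepE => c e; have /rowP u0 : \row_j (c j)%:F = 0.
  apply: (row_free_inj yf); rewrite mul0mx mulmx_sum_row.
  rewrite -[RHS]fcoord0 -e fcoord_sum //; apply: eq_bigr => j _.
  by rewrite rowK mxE.
by move=> j; have /eqP := u0 j; rewrite !mxE tofrac_eq0 => /eqP.
Qed.

Lemma basis_rank : rank_over S M n.
Proof.
have [Mx xi _] := xB; split; first by exists x.
move=> y My; rewrite (indep_row_free My) /row_free => /eqP rk.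
by have := rank_leq_col (\matrix_j fcoord (y j)); rewrite rk ltnn.
Qed.

Lemma basis_max m (y : 'I_m -> R) : (forall j, M (y j)) -> indep S y -> (m <= n)%N.
Proof.
move=> My; rewrite (indep_row_free My) => /eqP <-; exact: rank_leq_col.
Qed.

(** Left multiplication by [a], acting on row coordinates from the right; this is why [mult_mxM]
    reverses products. *)
Definition mult_mx (a : R) : 'M[F]_n := \matrix_i fcoord (a * x i).

Lemma fcoord_mult a y : M a -> M y -> fcoord (a * y) = fcoord y *m mult_mx a.
Proof.
have [Mx _ _] := xB; move=> Ma My; have [c [c0 [al [e h]]]] := fcoordP My.
have cF : c%:F != 0 by rewrite tofrac_eq0.
apply: (scalerI cF); rewrite -fcoordZ; last exact: overalg_mul.
rewrite mulrA valC -mulrA e mulr_sumr.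
transitivity (fcoord (\sum_i subalg_val (al i) * (a * x i))).
  by congr fcoord; apply: eq_bigr => i _; rewrite mulrA -valC mulrA.
rewrite fcoord_sum; last by move=> i; exact: overalg_mul.
rewrite mulmx_sum_row scaler_sumr; apply: eq_bigr => i _.
by rewrite rowK scalerA h.
Qed.

Lemma mult_mxM a b : M a -> M b -> mult_mx (a * b) = mult_mx b *m mult_mx a.
Proof.
have [Mx _ _] := xB; move=> Ma Mb; apply/row_matrixP => i.
by rewrite row_mul !rowK -mulrA fcoord_mult //; exact: overalg_mul.
Qed.

Lemma mult_mxD a b : M a -> M b -> mult_mx (a + b) = mult_mx a + mult_mx b.
Proof.
have [Mx _ _] := xB; move=> Ma Mb; apply/row_matrixP => i.
by rewrite linearD /= !rowK mulrDl fcoordD //; exact: overalg_mul.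
Qed.

Lemma mult_mx_sum I (r : seq I) (f : I -> R) : (forall i, M (f i)) ->
  mult_mx (\sum_(i <- r) f i) = \sum_(i <- r) mult_mx (f i).
Proof.
move=> Mf; elim: r => [|i r IH].
  by rewrite !big_nil; apply/row_matrixP => j; rewrite rowK mul0r row0 fcoord0.
by rewrite !big_cons mult_mxD ?IH //; exact: overalg_sum.
Qed.

Lemma mult_mx_scalar (s : T) : mult_mx (subalg_val s) = (s%:F)%:M.
Proof.
have [Mx _ _] := xB; apply/row_matrixP => i.
by rewrite rowK fcoordZ // fcoord_basis -scalemx1 linearZ /= row1.
Qed.

(* The cleared-denominator trace identity of [trL] says tau = tr(L_a) in F. *)
Lemma trL_mxtrace a (tau : T) : M a -> tau%:F = \tr (mult_mx a) -> trL S M n a (subalg_val tau).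
Proof.
move=> Ma tauE y c al My yi cS alS e.
have [c' c'E] := subalg_family (fun j => proj1 (cS j)).
have [al' al'E] := subalg_family (fun ij : 'I_n * 'I_n => alS ij.1 ij.2).
have c0 j : c' j != 0.
  by apply: contraNneq (proj2 (cS j)) => z; rewrite -c'E z rmorph0.
pose X := \matrix_j fcoord (y j).
have Xu : X \in unitmx by rewrite -row_free_unit; apply/(indep_row_free My).
(* Row [j] of both sides is the coordinate vector of [c j * (a * y j)]; so [al], up to denominators
   and transposition, is the matrix of multiplication by [a] in the basis [y]. *)
have XL : diag_mx (\row_j (c' j)%:F) *m X *m mult_mx a
        = (\matrix_(i, j) (al' (j, i))%:F) *m X.
  apply/row_matrixP => j; rewrite -mulmxA row_mul row_diag_mx mxE -scalemxAl -rowE row_mul rowK.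
  rewrite -fcoord_mult // -fcoordZ ?c'E ?e; last exact: overalg_mul.
  transitivity (fcoord (\sum_i subalg_val (al' (i, j)) * y i)).
    by congr fcoord; apply: eq_bigr => i _; rewrite al'E.
  rewrite fcoord_sum // row_mul mulmx_sum_row; apply: eq_bigr => i _.
  by rewrite !mxE rowK.
pose C := diag_mx (\row_j ((c' j)%:F)^-1).
have CC : C *m diag_mx (\row_j (c' j)%:F) = 1%:M.
  rewrite mulmx_diag -diag_const_mx; congr diag_mx; apply/rowP => j.
  by rewrite !mxE mulVf ?tofrac_eq0.
have trE : \tr (mult_mx a) = \sum_j (al' (j, j))%:F / (c' j)%:F.
  have -> : mult_mx a = invmx X *m (C *m (\matrix_(i, j) (al' (j, i))%:F)) *m X.
    by rewrite -!mulmxA -XL (mulmxA C) (mulmxA C) CC mul1mx mulKmx.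
  rewrite mxtrace_mulC mulmxA mulmxV // mul1mx; apply: eq_bigr => j _.
  by rewrite mul_diag_mx !mxE mulrC.
have key : (\prod_j c' j) * tau = \sum_j al' (j, j) * \prod_(i | i != j) c' i.
  apply/eqP; rewrite -tofrac_eq rmorphM rmorph_sum /= tauE trE mulr_sumr; apply/eqP.
  apply: eq_bigr => j _; rewrite (bigD1 j) //= !rmorphM /=.
  rewrite [LHS]mulrCA; congr (_ * _).
  by rewrite mulrAC mulfV ?mul1r ?tofrac_eq0.
move: key => /(congr1 subalg_val); rewrite rmorphM rmorph_prod rmorph_sum /=.
under eq_bigr do rewrite c'E; move=> ->; apply: eq_bigr => j _.
rewrite rmorphM rmorph_prod /= (al'E (j, j)) /=; congr (_ * _).
by apply: eq_bigr => i _; rewrite c'E.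
Qed.

(** Instantiated at the basis [x] itself, the trace identity determines [tau] times a product of
    nonzero denominators. *)
Lemma trL_uniq a (tau tau' : T) : M a ->
  trL S M n a (subalg_val tau) -> trL S M n a (subalg_val tau') -> tau = tau'.
Proof.
have [Mx xi xs] := xB; move=> Ma h h'.
have ex j : exists cal : T * ('I_n -> T), cal.1 != 0 /\
    subalg_val cal.1 * (a * x j) = \sum_i subalg_val (cal.2 i) * x i.
  by have [c [c0 [al ?]]] := xs _ (overalg_mul Ma (Mx j)); exists (c, al).
have [f fP] := choice ex.
have g (t : R) : trL S M n a t -> \prod_j subalg_val (f j).1 * t =
    \sum_j subalg_val ((f j).2 j) * \prod_(i | i != j) subalg_val (f i).1.
  move=> ht; apply: (ht x (fun j => subalg_val (f j).1) (fun i j => subalg_val ((f j).2 i))) => //;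
    [move=> j|by move=> i j; exact: subalg_valP|by move=> j; case: (fP j)].
  split; first exact: subalg_valP.
  apply: contraNneq (proj1 (fP j)) => z; apply/eqP/subalg_val_inj; by rewrite rmorph0.
have := g _ h; rewrite -(g _ h') -rmorph_prod -!rmorphM => /subalg_val_inj/mulfI; apply.
by apply/prodf_neq0 => i _; case: (fP i).
Qed.

End Basis.

Lemma rank_basis n : rank_over S M n -> exists x : 'I_n -> R, is_basis x.
Proof.
move=> [[x [Mx xi]] xmax]; exists x; split=> // y My.
apply: contrapT => hn; pose z (i : 'I_n.+1) := oapp x y (unlift ord0 i).
have Mz i : M (z i) by rewrite /z; case: unliftP => [j _|_] /=.
apply: (xmax z Mz); apply/indepE => c e.
have zS j : z (lift ord0 j) = x j by rewrite /z liftK.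
have z0 : z ord0 = y by rewrite /z unlift_none.
move: e; rewrite big_ord_recl z0; under eq_bigr do rewrite zS.
(* A nonzero coefficient at [y] would be a denominator expressing [y] through [x]; a zero one leaves
   a relation among the [x]. *)
have [c0|c0] := eqVneq (c ord0) 0; last first.
  move=> /eqP; rewrite addr_eq0 => /eqP e; case: hn; exists (c ord0); split=> //.
  exists (fun j => - c (lift ord0 j)); rewrite e -sumrN.
  by apply: eq_bigr => j _; rewrite rmorphN mulNr.
rewrite c0 rmorph0 mul0r add0r => e i.
have h := (indepE x).1 xi (fun j => c (lift ord0 j)) e.
by case: (unliftP ord0 i) => [j ->|->]; rewrite ?c0.
Qed.

(** Stated on vectors so as to include size 0, which [horner_mx] excludes. *)
Lemma Cayley_Hamilton_row (L : fieldType) n (A : 'M[L]_n) (v : 'rV_n) :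
  \sum_(i < n.+1) (char_poly A)`_i *: iter i (mulmxr A) v = 0.
Proof.
case: n => [|n] in A v *; first by apply/rowP => -[].
have : v *m horner_mx A (char_poly A) = 0 by rewrite Cayley_Hamilton mulmx0.
move: (size_char_poly A); move: (char_poly A) => p sp e; rewrite -[RHS]e.
rewrite -[in RHS](coefK p) poly_def linear_sum /= mulmx_sumr sp; apply: eq_bigr => i _.
rewrite horner_mxZ rmorphXn /= horner_mx_X -scalemxAr; congr (_ *: _).
elim: (i : nat) => [|k IH] /=; first by rewrite expr0 mulmx1.
by rewrite IH exprSr mulmxA.
Qed.

(** * Integrality of the characteristic polynomial *)

Section Lattice.
Variables (n : nat) (x : 'I_n -> R).
Hypothesis xB : is_basis x.
Variables (m : nat) (g : 'I_m -> R).
Hypotheses (Mg : forall j, M (g j))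
  (gspan : forall y, M y -> exists al : 'I_m -> T, y = \sum_j subalg_val (al j) * g j).
Local Notation fcoord := (fcoord x).
Local Notation mult_mx := (mult_mx x).

Let G : 'M[F]_(m, n) := \matrix_j fcoord (g j).
Let minor (f : {ffun 'I_n -> 'I_m}) : F := \det (rowsub f G).

(** Writing the basis [x] in the generators gives a factorization of the identity through [G]; its
    determinant would expand to 0. *)
Lemma minor_neq0 : exists f, minor f != 0.
Proof.
have [Mx _ _] := xB; apply: contrapT => h.
have [al alE] := choice (fun i => gspan (Mx i)).
suff : \det (1%:M : 'M[F]_n) = 0 by rewrite det1 => /eqP; rewrite oner_eq0.
have -> : 1%:M = (\matrix_(i, j) (al i j)%:F) *m G.
  apply/row_matrixP => i; rewrite row1 -(fcoord_basis xB) {1}alE (fcoord_sum xB) //.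
  by rewrite row_mul mulmx_sum_row; apply: eq_bigr => j _; rewrite !mxE rowK.
rewrite det_mulmx_rect big1 // => f _.
have -> : \det (rowsub f G) = 0; last by rewrite mulr0.
by apply/eqP; apply: contraT => f0; case: h; exists f.
Qed.

(** As a matrix in [s] and [f], with entries in the subalgebra, it has the vector of minors as
    eigenvector and the [k]-th coefficient of the characteristic polynomial as eigenvalue. *)
Definition lattice_coef (al : 'M[T]_m) k (s f : {ffun 'I_n -> 'I_m}) : T :=
  (\prod_i char_poly_mx al (s i) (f i))`_k.

(* Multiplying the maximal minors of a generating family by the characteristic
   polynomial of L_a amounts to expanding det ((X - L_a) g_s) over the lattice. *)
Lemma char_poly_minor a (al : 'M[T]_m) : M a ->
  (forall j, a * g j = \sum_i subalg_val (al j i) * g i) ->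
  forall k s, (char_poly (mult_mx a))`_k * minor s
            = \sum_f (lattice_coef al k s f)%:F * minor f.
Proof.
move=> Ma ae k s.
have GL : G *m mult_mx a = map_mx (@FracField.tofrac T) al *m G.
  apply/row_matrixP => j; rewrite !row_mul !rowK -(fcoord_mult xB) // ae (fcoord_sum xB) //.
  by rewrite mulmx_sum_row; apply: eq_bigr => i _; rewrite !mxE rowK.
pose GP := map_mx polyC G.
have GC : rowsub s GP *m char_poly_mx (mult_mx a)
    = rowsub s (char_poly_mx (map_mx (@FracField.tofrac T) al)) *m GP.
  rewrite !mul_rowsub_mx; congr (mxsub _ _ _).
  rewrite mulmxBr mulmxBl -!map_mxM GL; congr (_ - _).
  by rewrite mul_mx_scalar mul_scalar_mx.
have := congr1 (fun A : 'M[{poly F}]_n => (\det A : {poly F})`_k) GC.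
rewrite det_mulmx det_mulmx_rect -/(char_poly _).
have -> : \det (rowsub s GP) = (minor s)%:P by rewrite -map_mxsub det_map_mx.
rewrite coefCM mulrC => ->; rewrite coef_sum; apply: eq_bigr => f _.
rewrite -map_mxsub det_map_mx coefMC; congr (_ * _).
rewrite /lattice_coef -coef_map rmorph_prod /=.
by under eq_bigr do rewrite mxE -map_char_poly_mx mxE.
Qed.

Lemma mult_lattice a : M a -> exists al : 'M[T]_m,
  forall j, a * g j = \sum_i subalg_val (al j i) * g i.
Proof.
move=> Ma; have [al alE] := choice (fun j => gspan (overalg_mul Ma (Mg j))).
by exists (\matrix_(j, i) al j i) => j; rewrite alE; apply: eq_bigr => i _; rewrite mxE.
Qed.

Hypothesis intS : int_closed S.

(** [int_closed] is phrased with pairs [a], [b] in place of fractions, so the monic equation of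
    [a / b] is multiplied by the power of [b] of the same degree. *)
Lemma integral_frac (u : F) (p : {poly T}) :
  p \is monic -> root (map_poly (@FracField.tofrac T) p) u -> exists q, u = q%:F.
Proof.
move=> pm pu; have [a [b [b0 uE]]] := frac_repr u.
have bF : b%:F != 0 by rewrite tofrac_eq0.
pose d := (size p).-1.
have sp : size p = d.+1 by rewrite /d prednK // lt0n size_poly_eq0 monic_neq0.
have rel : a ^+ d + \sum_(i < d) p`_i * a ^+ i * b ^+ (d - i) = 0.
  apply/eqP; rewrite -tofrac_eq0; apply/eqP.
  move: pu => /rootP; rewrite horner_coef size_map_poly_id0; last first.
    by rewrite tofrac_eq0 lead_coef_eq0 monic_neq0.
  move=> /(congr1 (GRing.mul (b%:F ^+ d))); rewrite mulr0 sp mulr_sumr => e; rewrite -[RHS]e {e}.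
  rewrite big_ord_recr /= coef_map /= -[d in p`_d]/(size p).-1 -/(lead_coef p) (monicP pm).
  have bd : b%:F ^+ d * (a%:F / b%:F) ^+ d = a%:F ^+ d.
    by rewrite expr_div_n mulrC divfK ?expf_neq0.
  rewrite tofrac1 mul1r uE bd addrC rmorphD rmorphXn rmorph_sum /=.
  congr (_ + _); apply: eq_bigr => i _; rewrite coef_map /= !rmorphM !rmorphXn /=.
  have -> : b%:F ^+ d = b%:F ^+ (d - i) * b%:F ^+ i by rewrite -exprD subnK // ltnW.
  have aux (L : fieldType) (t y v w : L) : w != 0 -> t * y * v = v * w * (t * (y / w)).
    by move=> w0; field.
  by rewrite expr_div_n; apply: aux; rewrite expf_neq0.
have [q [Sq aq]] : exists q, S q /\ subalg_val a = q * subalg_val b.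
  apply: intS; [exact: subalg_valP|exact: subalg_valP| |].
    by apply: contraNneq b0 => z; apply/eqP/subalg_val_inj; rewrite rmorph0.
  exists d, (fun i => subalg_val p`_i); split; first by move=> i; exact: subalg_valP.
  move: rel => /(congr1 subalg_val); rewrite rmorphD rmorph_sum rmorphXn rmorph0 /= => e.
  by rewrite -[RHS]e; congr (_ + _); apply: eq_bigr => i _; rewrite !rmorphM !rmorphXn.
have [q' q'E] := subalg_elt Sq; exists q'.
have aE : a = q' * b by apply: subalg_val_inj; rewrite rmorphM /= q'E.
by rewrite uE aE rmorphM /= mulfK.
Qed.

(** Each coefficient is an eigenvalue of a matrix over the integrally closed subalgebra. *)
Lemma char_poly_integral a : M a ->
  exists p : {poly T}, map_poly (@FracField.tofrac T) p = char_poly (mult_mx a).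
Proof.
move=> Ma; have [s s0] := minor_neq0; have [al ae] := mult_lattice Ma.
have h k : exists q : T, (char_poly (mult_mx a))`_k = q%:F.
  apply: integral_frac (char_poly_monic _) (eigen_root s0 (char_poly_minor Ma ae k)).
have [q qE] := choice h; exists (\poly_(k < n.+1) q k); apply/polyP => k.
rewrite coef_map coef_poly /= qE; case: ltnP => // nk.
by rewrite -qE rmorph0 nth_default // size_char_poly.
Qed.

Definition int_char_poly (a : R) : {poly T} :=
  if pselect (exists p : {poly T}, map_poly (@FracField.tofrac T) p = char_poly (mult_mx a))
  is left h then projT1 (cid h) else 0.

Lemma int_char_polyE a : M a ->
  map_poly (@FracField.tofrac T) (int_char_poly a) = char_poly (mult_mx a).
Proof.
by move=> /char_poly_integral h; rewrite /int_char_poly; case: pselect => // h'; case: (cid h').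
Qed.

Lemma int_char_poly_monic a : M a -> int_char_poly a \is monic.
Proof.
move=> Ma; have := char_poly_monic (mult_mx a); rewrite -int_char_polyE //.
rewrite !monicE lead_coef_map_inj; [|exact: tofrac_inj|exact: tofrac0].
by rewrite -tofrac1 tofrac_eq.
Qed.

Lemma size_int_char_poly a : M a -> size (int_char_poly a) = n.+1.
Proof.
move=> Ma; rewrite -(size_char_poly (mult_mx a)) -int_char_polyE //.
by rewrite size_map_poly_id0 // tofrac_eq0 lead_coef_eq0 monic_neq0 ?int_char_poly_monic.
Qed.

Lemma mxtrace_integral a : M a -> exists t : T, t%:F = \tr (mult_mx a).
Proof.
move=> Ma; have [n0|n0] := posnP n.
  exists 0; rewrite tofrac0 /mxtrace big1 // => i _.
  by have := ltn_ord i; rewrite {2}n0.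
exists (- (int_char_poly a)`_n.-1).
by rewrite rmorphN -coef_map int_char_polyE // char_poly_trace // opprK.
Qed.

Lemma basis_gt0 : (0 < n)%N.
Proof.
have [_ _ sp] := xB; rewrite lt0n; apply/eqP => n0.
have M1 : M 1 by case: M_subalg.
have [c [c0 [al]]] := sp _ M1; rewrite mulr1 big1 => [z|i]; last first.
  by have := ltn_ord i; rewrite {2}n0.
by case/eqP: c0; apply: subalg_val_inj; rewrite rmorph0.
Qed.

(** The value at [s] is the norm of [s - a]. In this form the multiplicativity of determinants can
    be used on the characteristic polynomial. *)
Lemma int_char_poly_horner a (s : T) : M a ->
  ((int_char_poly a).[s])%:F = \det (mult_mx (subalg_val s - a)).
Proof.
move=> Ma; rewrite -horner_map int_char_polyE // /char_poly.
have M1 : M (-1) by rewrite -scaleN1r; apply/subM/subalgZ/subalg1.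
have MNa : M (- a) by rewrite -mulN1r; apply: overalg_mul.
rewrite -[_.[_]]/(horner_eval _ _) -det_map_mx; congr (\det _).
rewrite (mult_mxD xB) ?(mult_mx_scalar xB) //; last exact/subM/subalg_valP.
have -> : mult_mx (- a) = - mult_mx a.
  by apply/eqP; rewrite -addr_eq0 -(mult_mxD xB) // addNr;
     apply/eqP/row_matrixP => i; rewrite rowK mul0r row0 (fcoord0 xB).
apply/matrixP => i j; rewrite !mxE /= /horner_eval hornerD hornerN hornerC.
by rewrite hornerMn hornerX.
Qed.

Lemma Cayley_Hamilton_mult a : M a ->
  \sum_(i < n.+1) subalg_val (int_char_poly a)`_i * a ^+ i = 0.
Proof.
move=> Ma; have M1 : M 1 by case: M_subalg.
have MX i : M (a ^+ i).
  by elim: i => [|i IH]; rewrite ?expr0 ?exprS //; exact: overalg_mul.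
apply: (fcoord_inj xB); first by apply: overalg_sum => i _; exact: overalg_smul.
rewrite (fcoord_sum xB) // -[RHS](Cayley_Hamilton_row (mult_mx a) (fcoord 1)).
apply: eq_bigr => i _; rewrite -coef_map int_char_polyE //; congr (_ *: _).
elim: (i : nat) => [|k IH] //=; rewrite -IH exprS (fcoord_mult xB) //.
Qed.
End Lattice.
End Coordinates.

(** * The fibre over a maximal ideal *)

Definition rational_point (K : fieldType) (R : algType K) (S Q : R -> Prop) : Prop :=
  is_max_ideal S Q /\ forall t, S t -> exists lam : K, Q (t - lam *: 1).

Section Evaluation.
Variables (K : fieldType) (R : algType K) (S : central_subalg R) (Q : R -> Prop).
Hypothesis Qpt : rational_point S Q.
Let Qmax : is_max_ideal S Q := proj1 Qpt.
Local Notation T := (subalg_type S).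

Lemma subalg_scalarP (c : K) : (c *: 1 : R) \in subalg_mem S.
Proof. by apply/asboolP/subalgZ/subalg1. Qed.
Definition subalg_scalar (c : K) : T := SubalgElt (subalg_scalarP c).

Lemma ideal_sub x y : Q x -> Q y -> Q (x - y).
Proof.
case: Qmax => -[_ _ QD QM] _ _ Qx Qy; apply: QD => //; rewrite -mulN1r; apply: QM => //.
exact/subalgN/subalg1.
Qed.

Lemma ideal_scale (c : K) x : Q x -> Q (c *: x).
Proof.
case: Qmax => -[_ _ QD QM] _ _ Qx; rewrite -[x]mul1r scalerAl; apply: QM => //.
exact/subalgZ/subalg1.
Qed.

Definition ev (t : T) : K := projT1 (cid (proj2 Qpt _ (subalg_valP t))).

Lemma evP (t : T) : Q (subalg_val t - ev t *: 1).
Proof. by rewrite /ev; case: cid. Qed.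

Lemma evE (t : T) lam : Q (subalg_val t - lam *: 1) <-> ev t = lam.
Proof.
split=> [h|<-]; last exact: evP.
have [_ Q1 _] := Qmax; apply/eqP; rewrite -subr_eq0; apply: contraT => c0; case: Q1.
have := ideal_scale (ev t - lam)^-1 (ideal_sub h (evP t)).
by rewrite opprB [X in _ *: X]addrC addrA addrNK -scalerBl scalerA mulVf // scale1r.
Qed.

Lemma ev_eq0 (t : T) : ev t = 0 <-> Q (subalg_val t).
Proof. by rewrite -evE scale0r subr0. Qed.

Fact ev_zmod : zmod_morphism ev.
Proof.
move=> x y; apply/evE; rewrite rmorphB scalerBl.
have -> : subalg_val x - subalg_val y - (ev x *: 1 - ev y *: 1)
   = (subalg_val x - ev x *: 1) - (subalg_val y - ev y *: 1) by rewrite !opprD addrACA.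
by apply: ideal_sub; exact: evP.
Qed.
Fact ev_monoid : monoid_morphism ev.
Proof.
have [[_ Q0 QD QM] _ _] := Qmax.
split=> [|x y]; apply/evE; first by rewrite rmorph1 scale1r subrr.
have -> : subalg_val (x * y) - (ev x * ev y) *: 1 =
   subalg_val x * (subalg_val y - ev y *: 1) + ev y *: (subalg_val x - ev x *: 1).
  by rewrite rmorphM mulrBr scalerBr scalerA (mulrC (ev y)) -scalerAr mulr1 addrA subrK.
apply: QD; first by apply: QM (evP y); exact: subalg_valP.
exact/ideal_scale/evP.
Qed.
HB.instance Definition _ := GRing.isZmodMorphism.Build T K ev ev_zmod.
HB.instance Definition _ := GRing.isMonoidMorphism.Build T K ev ev_monoid.

Lemma ev_scalar c : ev (subalg_scalar c) = c.
Proof. by apply/evE; rewrite subrr; case: Qmax => -[]. Qed.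

End Evaluation.

Lemma max_ideal_exists (K : fieldType) (R : algType K) (S J : R -> Prop) :
  S 1 -> is_ideal S J -> ~ J 1 ->
  exists P, is_max_ideal S P /\ forall x, J x -> P x.
Proof.
move=> S1 idJ J1.
pose Fam (I : set R) := [/\ is_ideal S I, ~ I 1 & forall x, J x -> I x] \/ I = set0.
have [F FP tot|I [FI Imax]] := @Zorn_bigcup R Fam.
  have [[I0 [FI0 nI0]]|none] := pselect (exists I, F I /\ I <> set0); last first.
    right; apply/seteqP; split=> // x [I FI Ix]; case: none; exists I; split=> // I0.
    by rewrite I0 in Ix.
  have good I : F I -> I <> set0 -> [/\ is_ideal S I, ~ I 1 & forall x, J x -> I x].
    by move=> /FP[].
  have goodx I x : F I -> I x -> [/\ is_ideal S I, ~ I 1 & forall x, J x -> I x].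
    by move=> FI Ix; apply: good => // I00; rewrite I00 in Ix.
  left; split.
  - split.
    + by move=> x [I FI Ix]; have [[IS _ _ _] _ _] := goodx _ _ FI Ix; exact: IS.
    + by exists I0 => //; have [[]] := good _ FI0 nI0.
    + move=> x y [I FI Ix] [I' FI' I'y].
      have [[_ _ ID _] _ _] := goodx _ _ FI Ix; have [[_ _ ID' _] _ _] := goodx _ _ FI' I'y.
      have [le|le] := tot _ _ FI FI'; first by exists I' => //; apply: ID' => //; exact: le.
      by exists I => //; apply: ID => //; exact: le.
    + move=> s x Ss [I FI Ix]; exists I => //.
      by have [[_ _ _ IM] _ _] := goodx _ _ FI Ix; exact: IM.
  - by move=> [I FI I1]; have [] := goodx _ _ FI I1.
  - by move=> x Jx; exists I0 => //; have [_ _] := good _ FI0 nI0; exact.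
have [_ J0 _ _] := idJ.
have {FI} [idI I1 JI] : [/\ is_ideal S I, ~ I 1 & forall x, J x -> I x].
  case: FI => // I0; case: (Imax J); last by left; split.
  by rewrite I0; split=> // /(_ 0 J0).
exists I; split=> //; split=> // I' idI' II'.
have [|nI'1] := pselect (I' 1); first by right.
left=> x; split; last exact: II'.
apply: contraPP => nIx I'x; apply: (Imax I'); last by left; split=> // z Jz; exact/II'/JI.
by split=> // h; exact/nIx/h.
Qed.

(** * Roots of the reduced characteristic polynomial and points of the fibre *)

Section Fibre.
Variables (K : closedFieldType) (R : algType K) (A B : central_subalg R).
Hypothesis charK : [pchar K] =i pred0.
Hypothesis AB : forall x, A x -> B x.
Variables (n : nat) (z : 'I_n -> R).
Hypothesis zB : is_basis A B z.
Variables (m : nat) (g : 'I_m -> R).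
Hypotheses (Bg : forall j, B (g j))
  (gspan : forall y, B y -> exists al : 'I_m -> subalg_type A, y = \sum_j subalg_val (al j) * g j).
Hypothesis intA : int_closed A.
Variable Q : R -> Prop.
Hypothesis Qpt : rational_point A Q.
Variables (s : nat) (P : 'I_s -> R -> Prop).
Hypotheses (Ppt : forall i, rational_point B (P i))
  (PQ : forall i x, A x -> (P i x <-> Q x))
  (Pall : forall P', is_max_ideal B P' -> (forall x, A x -> (P' x <-> Q x)) ->
     exists i, forall x, P' x <-> P i x).
Local Notation TA := (subalg_type A).
Local Notation TB := (subalg_type B).
Local Notation "x %:F" := (@FracField.tofrac TA x).
Local Notation evA := (ev Qpt).
Local Notation evB i := (ev (Ppt i)).
Local Notation chi := (int_char_poly A z).
Let sB := subalg_predP B.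

Lemma evAB i (a : TA) (b : TB) : subalg_val b = subalg_val a -> evB i b = evA a.
Proof.
move=> e; apply/evE; rewrite e; apply/PQ; last exact: evP.
by apply: subalgD; [exact: subalg_valP|apply/subalgN/subalgZ/subalg1].
Qed.

(** Modulo Q the matrix [char_poly_mx al] is ['X] times the identity, so [lattice_coef al k] reduces
    to the identity if [k = n] and to 0 otherwise. Its eigenvalue, the [k]-th coefficient, reduces
    accordingly. *)
Lemma char_poly_ideal y (al : 'M[TA]_m) : B y ->
  (forall j, y * g j = \sum_i subalg_val (al j i) * g i) ->
  (forall j i, evA (al j i) = 0) -> map_poly evA (chi y) = 'X^n.
Proof.
move=> By ye al0; have [f0 f0P] := minor_neq0 sB AB zB Bg gspan.
apply/polyP => k; rewrite coef_map coefXn.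
have := eigen_root f0P (char_poly_minor sB AB zB Bg By ye k).
rewrite -(int_char_polyE sB AB zB Bg gspan intA By) coef_map /root horner_map tofrac_eq0 => /eqP.
move=> /(congr1 evA); rewrite rmorph0 -horner_map map_char_poly => /eqP.
set L := map_mx _ _.
have -> : L = (k == n)%:R%:M.
  apply/matrixP => i j; rewrite !mxE /lattice_coef -coef_map rmorph_prod.
  have -> : \prod_(l < n) map_poly evA (char_poly_mx al (enum_val i l) (enum_val j l))
      = \prod_(l < n) ('X *+ (enum_val i l == enum_val j l)).
    apply: eq_bigr => l _; rewrite !mxE rmorphB rmorphMn /= map_polyX map_polyC /= al0.
    by rewrite subr0.
  have [<-|ij] := eqVneq i j.
    under eq_bigr do rewrite eqxx mulr1n.
    by rewrite prodr_const card_ord coefXn mulr1n.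
  suff [l lP] : exists l, enum_val i l != enum_val j l.
    by rewrite (bigD1 l) //= (negPf lP) /= mulr0n mul0r coef0.
  apply/existsP; apply: contraNT ij => /existsPn h; apply/eqP/enum_val_inj/ffunP => l.
  by apply/eqP; have := h l; rewrite negbK.
rewrite -[_ == 0]/(root _ _) -eigenvalue_root_char => /eigenvalueP[v].
rewrite mul_mx_scalar => /eqP; rewrite -subr_eq0 -scalerBl scaler_eq0 => /orP[|->//].
by rewrite subr_eq0 => /eqP.
Qed.

Lemma char_poly_root_fibre (b : TB) i : root (map_poly evA (chi (subalg_val b))) (evB i b).
Proof.
have Bb := subalg_valP b.
have e := Cayley_Hamilton_mult sB AB zB Bg gspan intA Bb.
have sz := size_int_char_poly sB AB zB Bg gspan intA Bb.
rewrite /root horner_coef size_map_poly_id0; last first.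
  by rewrite (monicP (int_char_poly_monic sB AB zB Bg gspan intA Bb)) rmorph1 oner_eq0.
rewrite sz.
have [c cE] := subalg_family (S := B) (fun k : 'I_n.+1 => AB (subalg_valP (chi (subalg_val b))`_k)).
have e' : \sum_(k < n.+1) c k * b ^+ k = 0.
  apply: subalg_val_inj; rewrite rmorph0 rmorph_sum -[RHS]e; apply: eq_bigr => k _ /=.
  by rewrite rmorphM rmorphXn /= cE.
have := congr1 (evB i) e'; rewrite rmorph0 rmorph_sum => e2.
apply/eqP; rewrite -[RHS]e2; apply: eq_bigr => k _ /=.
by rewrite coef_map rmorphM rmorphXn /= (evAB i (cE k)).
Qed.

(** If [y0 = lam - b] and QB generate the unit ideal, then [y0 * c = 1 - y] with [y] in QB; modulo Q
    the norm of the left side is 0 and that of the right side is 1. So some maximal ideal contains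
    both, and it is a point of the fibre. *)
Lemma fibre_of_char_poly_root (b : TB) lam :
  root (map_poly evA (chi (subalg_val b))) lam -> exists i, evB i b = lam.
Proof.
move=> rlam; have Bb := subalg_valP b.
pose y0 := subalg_scalar B lam - b.
pose QB y := exists q : 'I_m -> R, (forall j, Q (q j)) /\ y = \sum_j q j * g j.
pose J x := exists c y, [/\ B c, QB y & x = subalg_val y0 * c + y].
have [[[QA Q0 QD QM] Q1 Qm] _] := Qpt.
have QBB y : QB y -> B y.
  by move=> [q [qQ ->]]; apply: subalg_sum => j _; apply: subalgM => //; exact/AB/QA.
have QB_mul y c : B c -> QB y -> QB (c * y).
  move=> Bc [q [qQ ->]].
  have [al alE] := mult_lattice sB Bg gspan Bc.
  exists (fun i => \sum_j subalg_val (al j i) * q j); split.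
    by move=> i; elim/big_ind: _ => // j _; apply: QM => //; exact: subalg_valP.
  rewrite mulr_sumr; under [RHS]eq_bigr do rewrite mulr_suml.
  rewrite exchange_big /=; apply: eq_bigr => j _.
  rewrite mulrA -(subalg_central (QA _ (qQ j))) -mulrA alE mulr_sumr.
  apply: eq_bigr => i _; rewrite mulrA; congr (_ * _).
  by rewrite (subalg_central (QA _ (qQ j))).
have QBQ x : Q x -> QB x.
  move=> Qx; have [al alE] := gspan (subalg1 B); exists (fun j => subalg_val (al j) * x); split.
    by move=> j; apply: QM => //; exact: subalg_valP.
  rewrite -[LHS]mulr1 {1}alE mulr_sumr; apply: eq_bigr => j _.
  by rewrite mulrA (subalg_central (QA _ Qx)).
have idJ : is_ideal B J.
  split.
  - move=> x [c [y [Bc /QBB By ->]]]; apply: subalgD => //; apply: subalgM => //.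
    exact: subalg_valP.
  - exists 0, 0; split; [exact: subalg0|exact: QBQ|by rewrite mulr0 addr0].
  - move=> x x' [c [y [Bc [q [qQ ->]] ->]]] [c' [y' [Bc' [q' [qQ' ->]] ->]]].
    exists (c + c'), (\sum_j (q j + q' j) * g j); split; first exact: subalgD.
      by exists (fun j => q j + q' j); split=> // j; exact: QD.
    under [in RHS]eq_bigr do rewrite mulrDl.
    by rewrite big_split /= mulrDr addrACA.
  - move=> t x Bt [c [y [Bc Qy ->]]]; exists (t * c), (t * y); split.
    + exact: subalgM.
    + exact: QB_mul.
    + by rewrite mulrDr !mulrA (subalg_central Bt).
have [[c [y [Bc Qy e1]]]|J1] := pselect (J 1).
  exfalso.
  have By := QBB _ Qy.
  have By0 := subalg_valP y0.
  have yE : map_poly evA (chi y) = 'X^n.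
    have [q [qQ yq]] := Qy.
    have [al alE] := choice (fun ij : 'I_m * 'I_m => gspan (subalgM (Bg ij.1) (Bg ij.2))).
    have [q' q'E] := subalg_family (S := A) (fun j => QA _ (qQ j)).
    apply: (@char_poly_ideal _ (\matrix_(j, i) \sum_k q' k * al (k, j) i)) => //.
      move=> j; rewrite yq mulr_suml.
      under [RHS]eq_bigr do rewrite mxE rmorph_sum mulr_suml.
      rewrite exchange_big /=; apply: eq_bigr => k _.
      rewrite -mulrA (alE (k, j)) mulr_sumr; apply: eq_bigr => i _.
      by rewrite rmorphM /= q'E mulrA.
    move=> j i; rewrite mxE rmorph_sum big1 // => k _.
    have /(ev_eq0 Qpt) k0 : Q (subalg_val (q' k)) by rewrite q'E.
    by rewrite rmorphM /= k0 mul0r.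
  have horn := int_char_poly_horner sB AB zB Bg gspan intA.
  (* The three values are the norms of [c], [lam - b] and [1 - y]. *)
  have N1 : (chi (- c)).[0] * (chi (subalg_val b)).[subalg_scalar A lam] = (chi y).[1].
    have Nc : ((chi (- c)).[0])%:F = \det (mult_mx A z c).
      by rewrite horn ?rmorph0 ?sub0r ?opprK //; exact: subalgN.
    have Nb : ((chi (subalg_val b)).[subalg_scalar A lam])%:F
        = \det (mult_mx A z (subalg_val y0)) by rewrite horn // /y0 rmorphB.
    have Ny : ((chi y).[1])%:F = \det (mult_mx A z (1 - y)) by rewrite horn // rmorph1.
    apply: tofrac_inj; rewrite rmorphM /= Nc Nb Ny -det_mulmx -(mult_mxM sB AB zB By0 Bc).
    have -> // : subalg_val y0 * c = 1 - y by apply: (canRL (addrK y)); exact: esym e1.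
  have h1 : evA (chi y).[1] = 1.
    by rewrite -(horner_map (ev Qpt)) yE /= hornerXn rmorph1 expr1n.
  have h2 : evA (chi (subalg_val b)).[subalg_scalar A lam] = 0.
    by rewrite -(horner_map (ev Qpt)) /= (ev_scalar Qpt); exact: (rootP rlam).
  have := congr1 evA N1; rewrite h1 rmorphM /= h2 mulr0 => /esym/eqP.
  by rewrite oner_eq0.
have [P' [P'max JP']] := max_ideal_exists (subalg1 B) idJ J1.
have [[P'B P'0 P'D P'M] P'1 _] := P'max.
have JQ x : Q x -> J x.
  by move=> Qx; exists 0, x; split; [exact: subalg0|exact: QBQ|rewrite mulr0 add0r].
have [i iP] : exists i, forall x, P' x <-> P i x.
  apply: Pall => // x Ax; split; last by move=> /JQ/JP'.
  (* The contraction of [P'] to A is a proper ideal containing Q, hence equal to Q. *)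
  have [||h|[]//] := Qm (fun x => A x /\ P' x).
  - split=> [x' []//|||].
    + by split=> //; exact: subalg0.
    + by move=> x1 x2 [? ?] [? ?]; split; [exact: subalgD|exact: P'D].
    + by move=> t x1 At [? ?]; split; [exact: subalgM|apply: P'M => //; exact: AB].
  - by move=> x' Qx'; split; [exact: QA|exact/JP'/JQ].
  by move=> P'x; apply/h.
exists i; apply/eqP; rewrite eq_sym -subr_eq0; apply/eqP.
rewrite -(ev_scalar (Ppt i) lam) -rmorphB; apply/ev_eq0/iP/JP'.
by exists 1, 0; split; [exact: subalg1|exact: QBQ|rewrite mulr1 addr0].
Qed.

(** The trace of B over A, read off the characteristic polynomial so that it lies in A and can be
    reduced modulo Q. *)
Definition int_trace (b : R) : TA := - (chi b)`_n.-1.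

Lemma int_traceE b : B b -> (int_trace b)%:F = \tr (mult_mx A z b).
Proof.
move=> Bb; rewrite rmorphN -coef_map (int_char_polyE sB AB zB Bg gspan intA Bb).
by rewrite char_poly_trace ?opprK // (basis_gt0 sB zB).
Qed.

Lemma fibre_roots (b : TB) : exists rs : seq K, [/\ size rs = n,
  evA (int_trace (subalg_val b)) = \sum_(r <- rs) r &
  forall r, r \in rs <-> exists i, evB i b = r].
Proof.
have Bb := subalg_valP b.
set p := map_poly evA (chi (subalg_val b)).
have pm : p \is monic.
  by rewrite monic_map // (int_char_poly_monic sB AB zB Bg gspan intA Bb).
have sp : size p = n.+1.
  rewrite size_map_poly_id0 ?(size_int_char_poly sB AB zB Bg gspan intA Bb) //.
  by rewrite (monicP (int_char_poly_monic sB AB zB Bg gspan intA Bb)) rmorph1 oner_neq0.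
have [rs] := closed_field_poly_normal p; rewrite (monicP pm) scale1r => pE.
have srs : size rs = n by move: sp; rewrite pE size_prod_XsubC => -[].
exists rs; split=> // [|r].
  rewrite /int_trace rmorphN -coef_map -/p pE -srs coefPn_prod_XsubC ?opprK //.
  by rewrite srs -lt0n (basis_gt0 sB zB).
rewrite -root_prod_XsubC -pE; split; first exact: fibre_of_char_poly_root.
by move=> [i <-]; exact: char_poly_root_fibre.
Qed.

Lemma int_traceD b b' : B b -> B b' -> int_trace (b + b') = int_trace b + int_trace b'.
Proof.
move=> Bb Bb'; have eD := int_traceE (subalgD Bb Bb').
rewrite (mult_mxD sB zB Bb Bb') mxtraceD -(int_traceE Bb) -(int_traceE Bb') in eD.
by rewrite -tofracD in eD; exact: (tofrac_inj eD).
Qed.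

Lemma int_traceZ (a : TA) b : B b -> int_trace (subalg_val a * b) = a * int_trace b.
Proof.
move=> Bb; have Ba := AB (subalg_valP a).
have eM := int_traceE (subalgM Ba Bb).
rewrite (mult_mxM sB AB zB Ba Bb) (mult_mx_scalar sB AB zB) mul_mx_scalar mxtraceZ in eM.
by rewrite -(int_traceE Bb) -tofracM in eM; exact: (tofrac_inj eM).
Qed.

Variable e : 'I_s -> TB.
Hypotheses (e1 : forall i, P i (subalg_val (e i) - 1))
  (e0 : forall i j, i != j -> P j (subalg_val (e i))).

Lemma fibre_trace : exists h : 'I_s -> nat, [/\ forall i, (0 < h i)%N,
  forall b : TB, evA (int_trace (subalg_val b)) = \sum_i (h i)%:R * evB i b &
  (\sum_i h i)%N = n].
Proof.
have ee i j : evB j (e i) = (i == j)%:R.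
  have [<-|ij] := eqVneq i j; apply/evE; first by rewrite scale1r.
  by rewrite scale0r subr0; exact: e0.
have hE i : exists h, (0 < h)%N /\ evA (int_trace (subalg_val (e i))) = h%:R.
  have [rs [_ -> rsP]] := fibre_roots (e i).
  (* All the roots are values of [e i] on the fibre, thus 0 or 1, so their sum counts the ones; the
     value at [P i] is such a one. *)
  exists (count_mem 1 rs); split.
    by rewrite -has_count has_pred1; apply/rsP; exists i; rewrite ee eqxx.
  have r01 r : r \in rs -> r = (r == 1)%:R.
    by move=> /rsP[j <-]; rewrite ee; case: (i == j); rewrite ?eqxx // eq_sym oner_eq0.
  rewrite -sum1_count natr_sum [RHS]big_mkcond /= !big_seq; apply: eq_bigr => r /r01 {1}->.
  by case: (r == 1).
have [h hP] := choice hE; exists h.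
pose psi b := evA (int_trace b).
have psiD x y : B x -> B y -> psi (x + y) = psi x + psi y.
  by move=> Bx By; rewrite /psi (int_traceD Bx By) rmorphD.
have psiZ (c : K) x : B x -> psi (c *: x) = c * psi x.
  move=> Bx; have := int_traceZ (subalg_scalar A c) Bx.
  have -> : subalg_val (subalg_scalar A c) * x = c *: x by rewrite -scalerAl mul1r.
  by rewrite /psi => ->; rewrite rmorphM /= (ev_scalar Qpt).
have psi_sum (r : seq 'I_s) (c : 'I_s -> K) :
    psi (\sum_(i <- r) c i *: subalg_val (e i)) = \sum_(i <- r) c i * (h i)%:R.
  elim: r => [|i r IH]; first by rewrite !big_nil -(scale0r 0) psiZ ?mul0r //; exact: subalg0.
  have Bi j : B (c j *: subalg_val (e j)) by apply/subalgZ/subalg_valP.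
  rewrite !big_cons (psiD _ _ (Bi i)); last exact: subalg_sum.
  rewrite IH (psiZ _ _ (subalg_valP (e i))); congr (_ * _ + _); exact: (proj2 (hP i)).
have phi b : psi (subalg_val b) = \sum_i (h i)%:R * evB i b.
  (* [l] interpolates the values of [b] on the fibre. All the roots attached to [b - l] are then 0,
     and so is its reduced trace. *)
  pose l : TB := \sum_i subalg_scalar B (evB i b) * e i.
  have lE : subalg_val l = \sum_i evB i b *: subalg_val (e i).
    by rewrite rmorph_sum; apply: eq_bigr => i _; rewrite rmorphM /= -[LHS]/(_ *: 1 * _) -scalerAl mul1r.
  have bl0 i : evB i (b - l) = 0.
    rewrite rmorphB rmorph_sum (bigD1 i) //= rmorphM /= ev_scalar ee eqxx mulr1.
    rewrite big1 ?addr0 ?subrr // => j ji.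
    by rewrite rmorphM /= ee (negPf ji) mulr0.
  have [rs [_ trE rsP]] := fibre_roots (b - l).
  have t0 : psi (subalg_val (b - l)) = 0.
    by rewrite /psi trE big_seq big1 // => r /rsP[i <-]; exact: bl0.
  have -> : subalg_val b = subalg_val (b - l) + subalg_val l by rewrite -rmorphD /= subrK.
  rewrite (psiD _ _ (subalg_valP _) (subalg_valP _)) t0 add0r lE psi_sum.
  by apply: eq_bigr => i _; rewrite mulrC.
split=> //; first by move=> i; case: (hP i).
(* Comparing both expressions of the functional at 1 gives the sum of the [h i], first in [K], then
   in the naturals by characteristic 0. *)
have nE : psi 1 = n%:R.
  have e1' := int_traceE (subalg1 B).
  rewrite -(rmorph1 (@subalg_val _ _ A)) (mult_mx_scalar sB AB zB) tofrac1 mxtrace1 in e1'.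
  rewrite -(rmorph_nat (@FracField.tofrac TA)) in e1'.
  by rewrite /psi -(rmorph1 (@subalg_val _ _ A)) (tofrac_inj e1') rmorph_nat.
have := phi 1.
have -> : \sum_i (h i)%:R * evB i 1 = \sum_i (h i)%:R.
  by apply: eq_bigr => i _; rewrite (rmorph1 (ev (Ppt i))) mulr1.
rewrite (rmorph1 (@subalg_val _ _ B)) nE -natr_sum => /eqP; rewrite eq_sym -subr_eq0.
have natr_eq a b : (a%:R == b%:R :> K) -> a = b.
  wlog ab : a b / (a <= b)%N => [hw|].
    have [/hw//|/ltnW ba e'] := leqP a b; by apply/esym/hw; rewrite // eq_sym.
  rewrite eq_sym -subr_eq0 -natrB // ((pcharf0P K).1 charK) subn_eq0 => ba.
  by apply/eqP; rewrite eqn_leq ab.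
by rewrite subr_eq0 => /natr_eq.
Qed.

End Fibre.

(** * The tower A, B, R *)

Section PairIndex.
Variables m n : nat.

Definition pair_idx (k : 'I_(m * n)) : 'I_m * 'I_n :=
  enum_val (cast_ord (esym (mxvec_cast m n)) k).
Definition idx_pair (p : 'I_m * 'I_n) : 'I_(m * n) :=
  cast_ord (mxvec_cast m n) (enum_rank p).

Lemma pair_idxK : cancel pair_idx idx_pair.
Proof. by move=> k; rewrite /idx_pair enum_valK cast_ordKV. Qed.
Lemma idx_pairK : cancel idx_pair pair_idx.
Proof. by move=> p; rewrite /pair_idx cast_ordK enum_rankK. Qed.

Lemma sum_pair_idx (V : nmodType) (F : 'I_m -> 'I_n -> V) :
  \sum_k F (pair_idx k).1 (pair_idx k).2 = \sum_i \sum_j F i j.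
Proof.
rewrite pair_bigA (reindex pair_idx) //=.
by exists idx_pair => ? _; [exact: pair_idxK|exact: idx_pairK].
Qed.

End PairIndex.

Section Tower.
Variables (K : fieldType) (R : algType K) (A B : central_subalg R).
Hypothesis AB : forall x, A x -> B x.
Variables (m : nat) (x : 'I_m -> R) (n : nat) (z : 'I_n -> R).
Hypotheses (xB : is_basis B (fun _ => True) x) (zB : is_basis A B z).
Local Notation TA := (subalg_type A).
Local Notation TB := (subalg_type B).
Local Notation full := (fun _ : R => True).
Let sB := subalg_predP B.
Fact full_subalg : is_subalg full. Proof. by []. Qed.
Let subA (a : R) (_ : A a) : full a := I.
Let subB (a : R) (_ : B a) : full a := I.

Definition tower_basis (k : 'I_(m * n)) : R := x (pair_idx k).1 * z (pair_idx k).2.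
Local Notation y := tower_basis.

(** Multiplication by [b] is injective on B, hence invertible over the fraction field of A. The
    preimage of 1, with denominators cleared by [d], is [c]. *)
Lemma exists_multiple (b : TB) : b != 0 ->
  exists (c : TB) (d : TA), d != 0 /\ subalg_val c * subalg_val b = subalg_val d.
Proof.
have [Bz zi _] := zB; move=> b0; have Bb := subalg_valP b.
have B1 := subalg1 B.
have Lu : mult_mx A z (subalg_val b) \in unitmx.
  rewrite -row_free_unit; apply/(indep_row_free sB AB zB).
    by move=> j; exact: subalgM.
  apply/indepE => c e i; apply: ((indepE A z).1 zi c).
  apply: (val_mul_eq0 b0); rewrite mulr_sumr -[RHS]e; apply: eq_bigr => j _.
  by rewrite !mulrA (valC b).
have [d [d0 [be bE]]] := frac_common (fun j => (fcoord A z 1 *m invmx (mult_mx A z (subalg_val b))) 0 j).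
have [c cE] : exists c : TB, subalg_val c = \sum_j subalg_val (be j) * z j.
  by apply: subalg_elt; apply: subalg_sum => j _; apply: subalgM => //; exact/AB/subalg_valP.
exists c, d; split=> //; rewrite (valC c) -[RHS]mulr1.
have Bd := AB (subalg_valP d).
apply: (fcoord_eq sB AB zB); [exact/subalgM/subalg_valP|exact: subalgM|].
rewrite (fcoord_mult sB AB zB Bb (subalg_valP c)) (fcoordZ sB AB zB) //.
rewrite cE (fcoord_sum sB AB zB) //.
have -> : \sum_j FracField.tofrac (be j) *: fcoord A z (z j)
   = FracField.tofrac d *: (fcoord A z 1 *m invmx (mult_mx A z (subalg_val b))).
  rewrite [X in _ = _ *: X]row_sum_delta scaler_sumr; apply: eq_bigr => j _.
  by rewrite (fcoord_basis zB) scalerA bE.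
by rewrite -scalemxAl mulmxKV.
Qed.

(** The basis property of [x] only yields denominators in B; multiplying by [exists_multiple] moves
    them into A, where both levels of the tower can use them. *)
Lemma clear_denominators p (r : 'I_p -> R) :
  exists (d : TA) (be : 'I_p -> 'I_m -> TB), d != 0 /\
    forall i, subalg_val d * r i = \sum_l subalg_val (be i l) * x l.
Proof.
have h i : exists db : TA * ('I_m -> TB), db.1 != 0 /\
    subalg_val db.1 * r i = \sum_l subalg_val (db.2 l) * x l.
  have [_ _ xsp] := xB; have [c [c0 [al e]]] := xsp (r i) I.
  have [c' [d [d0 c'E]]] := exists_multiple c0; exists (d, fun l => c' * al l); split=> //=.
  rewrite -c'E -mulrA e mulr_sumr; apply: eq_bigr => l _.
  by rewrite rmorphM mulrA.
have [f fP] := choice h.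
have [f' f'E] := subalg_family (S := B) (fun i => AB (subalg_valP (f i).1)).
exists (\prod_i (f i).1), (fun i l => (\prod_(j | j != i) f' j) * (f i).2 l); split.
  by apply/prodf_neq0 => i _; case: (fP i).
move=> i; rewrite (bigD1 i) //= rmorphM /= (valC (f i).1) -mulrA.
rewrite (proj2 (fP i)) mulr_sumr; apply: eq_bigr => l _.
rewrite rmorphM /= mulrA; congr (_ * _ * _).
by rewrite !rmorph_prod; apply: eq_bigr => j _ /=; rewrite f'E.
Qed.

Lemma tower_is_basis : is_basis A full y.
Proof.
have [_ xi _] := xB; have [Bz zi zsp] := zB; split=> //.
  apply/indepE => c e k.
  have Bb i : B (\sum_j subalg_val (c (idx_pair (i, j))) * z j).
    by apply: subalg_sum => j _; apply: subalgM => //; exact/AB/subalg_valP.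
  have [b bE] := subalg_family Bb.
  have b0 : forall i, b i = 0.
    apply: ((indepE B x).1 xi b); rewrite -[RHS]e.
    transitivity (\sum_i \sum_j subalg_val (c (idx_pair (i, j))) * (x i * z j)).
      apply: eq_bigr => i _; rewrite bE mulr_suml; apply: eq_bigr => j _.
      by rewrite -mulrA (subalg_central (Bz j)).
    rewrite -sum_pair_idx; apply: eq_bigr => l _.
    by rewrite -surjective_pairing pair_idxK.
  have := (indepE A z).1 zi (fun j => c (idx_pair ((pair_idx k).1, j))) _ (pair_idx k).2.
  rewrite -surjective_pairing pair_idxK; apply.
  by rewrite -bE b0 rmorph0.
move=> r _; have [d [be [d0 e]]] := clear_denominators (fun _ : 'I_1 => r).
have h i : exists ca : TA * ('I_n -> TA), ca.1 != 0 /\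
   subalg_val ca.1 * subalg_val (be 0 i) = \sum_j subalg_val (ca.2 j) * z j.
  by have [c [c0 [al ?]]] := zsp _ (subalg_valP (be 0 i)); exists (c, al).
have [f fP] := choice h.
exists ((\prod_i (f i).1) * d); split.
  by rewrite mulf_neq0 //; apply/prodf_neq0 => i _; case: (fP i).
exists (fun k => (\prod_(l | l != (pair_idx k).1) (f l).1) * (f (pair_idx k).1).2 (pair_idx k).2).
rewrite rmorphM -mulrA (e 0).
rewrite (sum_pair_idx (fun i j =>
  subalg_val ((\prod_(l | l != i) (f l).1) * (f i).2 j) * (x i * z j))).
rewrite mulr_sumr; apply: eq_bigr => i _.
rewrite (bigD1 i) //= rmorphM /= (valC (f i).1) -mulrA (mulrA (subalg_val (f i).1)).
rewrite (proj2 (fP i)) mulr_suml mulr_sumr.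
apply: eq_bigr => j _; rewrite rmorphM /= -!mulrA; congr (_ * (_ * _)).
exact: (subalg_central (Bz j)).
Qed.

Lemma tower_coord_mul (b : TB) i k :
  fcoord A y (subalg_val b * x i) 0 k
    = if (pair_idx k).1 == i then fcoord A z (subalg_val b) 0 (pair_idx k).2 else 0.
Proof.
have [Bz _ _] := zB.
pose v : 'rV_(m * n) := \row_k if (pair_idx k).1 == i
  then fcoord A z (subalg_val b) 0 (pair_idx k).2 else 0.
suff -> : fcoord A y (subalg_val b * x i) = v by rewrite mxE.
apply: (fcoordE tower_is_basis I).
have [c [c0 [al [ce cv]]]] := fcoordP zB (subalg_valP b).
exists c; split=> //; exists (fun k => if (pair_idx k).1 == i then al (pair_idx k).2 else 0); split.
  rewrite (sum_pair_idx (fun i' j => subalg_val (if i' == i then al j else 0) * (x i' * z j))).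
  rewrite (bigD1 i) //= [X in _ + X]big1 ?addr0 => [|i' /negPf i'i]; last first.
    by rewrite big1 // => j _; rewrite i'i rmorph0 mul0r.
  rewrite eqxx mulrA ce mulr_suml; apply: eq_bigr => j _.
  by rewrite -!mulrA (subalg_central (Bz j)).
by move=> k'; rewrite mxE; case: ifP => _; rewrite ?cv // mulr0 tofrac0.
Qed.

Lemma tower_coord (r : R) (d : TA) (be : 'I_m -> TB) :
  subalg_val d * r = \sum_l subalg_val (be l) * x l ->
  forall k, FracField.tofrac d * fcoord A y r 0 k
          = fcoord A z (subalg_val (be (pair_idx k).1)) 0 (pair_idx k).2.
Proof.
move=> e k; have yB := tower_is_basis.
have := congr1 (fun v : 'rV_(m * n) => v 0 k) (fcoordZ full_subalg subA yB d (y := r) I).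
rewrite e mxE => <-.
have -> : fcoord A y (\sum_l subalg_val (be l) * x l) = \sum_l fcoord A y (subalg_val (be l) * x l).
  have := fcoord_sum full_subalg subA yB (index_enum _) (fun _ : 'I_m => 1)
    (f := fun l => subalg_val (be l) * x l) (fun _ => I).
  under eq_bigr do rewrite rmorph1 mul1r.
  by under [in RHS]eq_bigr do rewrite tofrac1 scale1r.
rewrite summxE (bigD1 (pair_idx k).1) //= tower_coord_mul eqxx big1 ?addr0 // => l li.
by rewrite tower_coord_mul eq_sym (negPf li).
Qed.

(** Transitivity of the trace. With a common denominator [d] in A, multiplication by [d * a] has a
    matrix [be] over B, and both sides times [d] become the sum of the B/A-traces of its
    diagonal. *)
Lemma mxtrace_tower (a : R) (tB : TB) (tA : TA) :
  FracField.tofrac tB = \tr (mult_mx B x a) ->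
  FracField.tofrac tA = \tr (mult_mx A z (subalg_val tB)) ->
  FracField.tofrac tA = \tr (mult_mx A y a).
Proof.
have [Bz _ _] := zB.
move=> tBE tAE; have [d [be [d0 e]]] := clear_denominators (fun i => a * x i).
have dF : FracField.tofrac d != 0 by rewrite tofrac_eq0.
have [dB dBE] := subalg_elt (AB (subalg_valP d)).
apply: (mulfI dF).
have -> : FracField.tofrac d * \tr (mult_mx A y a) = \sum_i \tr (mult_mx A z (subalg_val (be i i))).
  have [zT zTE] := subalg_family Bz.
  rewrite /mxtrace mulr_sumr -(sum_pair_idx (fun i j => mult_mx A z (subalg_val (be i i)) j j)).
  apply: eq_bigr => k _; rewrite !mxE.
  rewrite (@tower_coord _ d (fun l => be (pair_idx k).1 l * zT (pair_idx k).2)).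
    by rewrite rmorphM /= zTE.
  rewrite mulrA {1}/tower_basis !mulrA -(mulrA (subalg_val d)) e mulr_suml.
  apply: eq_bigr => l _; rewrite rmorphM /= zTE -!mulrA; congr (_ * _).
  exact/esym/(subalg_central (Bz _)).
have dt : dB * tB = \sum_i be i i.
  apply: tofrac_inj; rewrite tofracM tBE rmorph_sum /mxtrace mulr_sumr.
  apply: eq_bigr => i _; rewrite mxE.
  have := congr1 (fun v : 'rV_m => v 0 i) (fcoordZ full_subalg subB xB dB (y := a * x i) I).
  rewrite mxE => <-; rewrite dBE e (fcoord_sum full_subalg subB xB) // summxE (bigD1 i) //=.
  rewrite mxE (fcoord_basis xB) mxE !eqxx mulr1 big1 ?addr0 // => l li.
  by rewrite mxE (fcoord_basis xB) mxE [i == l]eq_sym (negPf li) andbF mulr0.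
rewrite tAE -mxtraceZ -mul_mx_scalar -(mult_mx_scalar sB AB zB).
rewrite -(mult_mxM sB AB zB (AB (subalg_valP d)) (subalg_valP tB)) -dBE.
have -> : subalg_val dB * subalg_val tB = \sum_i subalg_val (be i i).
  by rewrite -rmorphM /= dt rmorph_sum.
rewrite (mult_mx_sum sB AB zB); last by move=> i; exact: subalg_valP.
by rewrite raddf_sum.
Qed.

(** The trace of R over B is B-linear, takes values in B as B is integrally closed, and sends [b] to
    [m] times [b]. Divided by [m], it maps generators of R over A to generators of B over A. *)
Lemma fg_center p (g : 'I_p -> R) : [pchar K] =i pred0 -> int_closed B ->
  (forall r, exists al : 'I_p -> TA, r = \sum_j subalg_val (al j) * g j) ->
  exists g' : 'I_p -> R, (forall j, B (g' j)) /\
    forall b, B b -> exists al : 'I_p -> TA, b = \sum_j subalg_val (al j) * g' j.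
Proof.
move=> charK intB gsp.
have gspB r : exists al : 'I_p -> TB, r = \sum_j subalg_val (al j) * g j.
  have [al ->] := gsp r.
  have [al' al'E] := subalg_family (S := B) (fun j => AB (subalg_valP (al j))).
  by exists al'; apply: eq_bigr => j _; rewrite al'E.
have [t tE] := choice (fun a => mxtrace_integral full_subalg subB xB
  (fun j => I : full (g j)) (fun r _ => gspB r) intB (a := a) I).
have m0 : (m%:R : K) != 0.
  by rewrite ((pcharf0P K).1 charK) -lt0n; exact: (basis_gt0 full_subalg xB).
exists (fun j => m%:R^-1 *: subalg_val (t (g j))); split.
  by move=> j; apply/subalgZ/subalg_valP.
move=> b Bb; have [bT bTE] := subalg_elt Bb; have [al e] := gsp b; exists al.
have [al' al'E] := subalg_family (S := B) (fun j => AB (subalg_valP (al j))).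
have : bT *+ m = \sum_j al' j * t (g j).
  apply: tofrac_inj; rewrite rmorphMn rmorph_sum /= -mxtrace_scalar.
  rewrite -(mult_mx_scalar full_subalg subB xB) bTE e.
  rewrite (mult_mx_sum full_subalg subB xB) // raddf_sum /=; apply: eq_bigr => j _.
  rewrite tofracM tE -al'E (mult_mxM full_subalg subB xB) //.
  by rewrite (mult_mx_scalar full_subalg subB xB) mul_mx_scalar mxtraceZ.
move=> /(congr1 subalg_val); rewrite rmorphMn rmorph_sum /= bTE => be.
apply: (scalerI m0); rewrite scaler_nat be scaler_sumr; apply: eq_bigr => j _.
by rewrite rmorphM /= al'E -scalerAr scalerA mulfV // scale1r.
Qed.

End Tower.

(** * Attached representations *)

Section Attached.
Variables (K : closedFieldType) (R : algType K) (S : central_subalg R).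
Hypothesis charK : [pchar K] =i pred0.
Local Notation T := (subalg_type S).
Local Notation full := (fun _ : R => True).
Let sT : is_subalg full := full_subalg R.
Let subS (a : R) (_ : S a) : full a := I.

Lemma rank_over_eq (M M' : R -> Prop) n :
  (forall x, M x <-> M' x) -> rank_over S M n -> rank_over S M' n.
Proof. by move=> h; have -> : M' = M by apply: funext => x; apply: propext; split=> /h. Qed.

Lemma rank_over_uniq (M : R -> Prop) n n' : is_subalg M -> (forall x, S x -> M x) ->
  rank_over S M n -> rank_over S M n' -> n = n'.
Proof.
move=> sM SM rn rn'; apply/eqP; rewrite eqn_leq.
have [x xB] := rank_basis rn; have [x' x'B] := rank_basis rn'.
have [Mx xi _] := xB; have [Mx' x'i _] := x'B.
by rewrite (basis_max sM SM x'B Mx xi) (basis_max sM SM xB Mx' x'i).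
Qed.

(** The rank is positive, so [d] is nonzero and can be inverted in [K]. *)
Lemma basis_red_trace nM nZ d (x : 'I_nM -> R) (t : T) a : is_basis S full x ->
  rank_over S (Zof full) nZ -> nM = (d * d * nZ)%N ->
  FracField.tofrac t = \tr (mult_mx S x a) ->
  red_trace S full a (d%:R^-1 *: subalg_val t).
Proof.
move=> xB rZ nE te; split; first exact/subalgZ/subalg_valP.
exists nM, nZ, d; split=> //; first exact: (basis_rank sT subS xB).
have d0 : (d%:R : K) != 0.
  rewrite ((pcharf0P K).1 charK); apply: contraTneq (basis_gt0 sT xB) => d0.
  by rewrite nE d0 mul0n.
rewrite scalerA mulfV // scale1r; exact: (trL_mxtrace sT subS xB).
Qed.

Variables (nM nZ d : nat) (x : 'I_nM -> R).
Hypotheses (xB : is_basis S full x) (rZ : rank_over S (Zof full) nZ)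
  (nE : nM = (d * d * nZ)%N).
Variables (m : nat) (g : 'I_m -> R).
Hypothesis gspan : forall y : R, exists al : 'I_m -> T, y = \sum_j subalg_val (al j) * g j.
Hypothesis intS : int_closed S.

Lemma exists_trace a : exists t : T, FracField.tofrac t = \tr (mult_mx S x a).
Proof.
exact: (mxtrace_integral sT subS xB (fun j => I : full (g j)) (fun y _ => gspan y) intS I).
Qed.

Lemma attached_rational (P : R -> Prop) n (rho : R -> 'M[K]_n) : (0 < n)%N ->
  is_max_ideal S P -> attached S P rho -> rational_point S P.
Proof.
case: n rho => // n rho _ Pmax [[r1 rD rM rZ'] _ rtr]; split=> // t St.
have [[PS P0 PD PM] P1 Pm] := Pmax.
(* By linearity over the subalgebra, the reduced trace of [q * a] is [q] times that of [a], hence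
   lies in [P]. *)
have tr0 q a : P q -> \tr (rho (q * a)) = 0.
  move=> Pq; have [q' q'E] := subalg_elt (PS _ Pq); have [u uE] := exists_trace a.
  have te : FracField.tofrac (q' * u) = \tr (mult_mx S x (q * a)).
    rewrite tofracM uE -q'E (mult_mxM sT subS xB) // (mult_mx_scalar sT subS xB).
    by rewrite mul_mx_scalar mxtraceZ.
  apply: rtr (basis_red_trace xB rZ nE te) _.
  rewrite /eval_at scale0r subr0 rmorphM /= q'E -(subalg_central (subalg_valP u)).
  rewrite scalerAl; apply: PM => //; exact/subalgZ/subalg_valP.
have [lam] : exists lam, root (char_poly (rho t)) lam.
  by apply/closed_rootP; rewrite size_char_poly.
rewrite -eigenvalue_root_char => /eigenvalueP[v vt v0].
exists lam; set y := t - lam *: 1; apply: contrapT => nPy.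
have Sy : S y by apply: subalgD => //; apply/subalgN/subalgZ/subalg1.
have vy : v *m rho y = 0.
  rewrite /y -scaleN1r rD rZ' rZ' r1 mulmxDr vt -!scalemxAr mulmx1 scaleN1r subrr //.
(* By maximality [1 = p + y * s] with [p] in [P]; since [y] kills the eigenvector [v], this [p]
   fixes it. *)
pose J u := exists p s, [/\ P p, S s & u = p + y * s].
have [||h|[p [s [Pp Ss e1]]]] := Pm J.
- split.
  + by move=> u [p [s [Pp Ss ->]]]; apply: subalgD; [exact: PS|exact: subalgM].
  + by exists 0, 0; split=> //; [exact: subalg0|rewrite mulr0 addr0].
  + move=> u u' [p [s [Pp Ss ->]]] [p' [s' [Pp' Ss' ->]]].
    exists (p + p'), (s + s'); split; [exact: PD|exact: subalgD|].
    by rewrite mulrDr addrACA.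
  + move=> a u Sa [p [s [Pp Ss ->]]]; exists (a * p), (a * s); split.
    * exact: PM.
    * exact: subalgM.
    * by rewrite mulrDr !mulrA (subalg_central Sa y).
- by move=> u Pu; exists u, 0; split=> //; [exact: subalg0|rewrite mulr0 addr0].
- by apply/nPy/h; exists 0, 1; split=> //; [exact: subalg1|rewrite mulr1 add0r].
have vp : v *m rho p = v.
  by rewrite -[RHS]mulmx1 -r1 e1 rD rM mulmxDr mulmxA vy mul0mx addr0.
case/negP: v0; apply/eqP; apply: (power_traces0 charK _ vp) => i.
have -> : rho p ^+ i.+1 = rho (p * p ^+ i).
  rewrite -exprS; elim: (i.+1) => [|k IH]; first by rewrite !expr0 r1.
  by rewrite !exprS rM IH.
exact: tr0.
Qed.

End Attached.

(** * Comparison of [NQ] with the direct sum *)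

Lemma iso_of_traces (K : closedFieldType) (R : algType K) k n (E : k = n)
    (rho : R -> 'M[K]_n) (D : R -> 'M[K]_k) :
  [pchar K] =i pred0 -> is_rep rho -> semisimple rho ->
  row_action (fun r => (D r)^T) -> complemented (fun r => (D r)^T) ->
  (forall r, \tr (rho r) = \tr (D r)) ->
  exists Pm : 'M[K]_n, Pm \in unitmx /\ forall r, rho r *m Pm = Pm *m castmx (E, E) (D r).
Proof.
move=> charK; case: n / E rho => rho [r1 rD rM rZ] ssr aD cD tre.
have ar : row_action (fun r => (rho r)^T).
  split; first by rewrite r1 trmx1.
  - by move=> x y; rewrite rD linearD.
  - by move=> x y; rewrite rM trmx_mul.
  - by move=> c x; rewrite rZ linearZ.
have [|f hf fu] := mxtrace_iso charK aD ar cD ssr; first by move=> r; rewrite !mxtrace_tr.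
exists f^T; split=> [|r]; first by rewrite unitmx_tr.
by rewrite castmx_id; apply: trmx_inj; rewrite !trmx_mul !trmxK hf.
Qed.

Lemma size_multiplicity s (h : 'I_s -> nat) :
  size (flatten [seq nseq (h i) i | i <- enum 'I_s]) = (\sum_i h i)%N.
Proof.
rewrite size_flatten /shape -map_comp sumnE big_map big_enum /=.
by apply: eq_bigr => i _; rewrite size_nseq.
Qed.

Lemma sum_multiplicity (V : nmodType) s (h : 'I_s -> nat) (F : 'I_s -> V) :
  \sum_(i <- flatten [seq nseq (h i) i | i <- enum 'I_s]) F i = \sum_i F i *+ h i.
Proof.
rewrite big_flatten big_map big_enum /=; apply: eq_bigr => i _.
by rewrite big_nseq iter_addr_0.
Qed.

Theorem theorem5p4 (K : closedFieldType) (R : algType K) (A : R -> Prop) :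
  [pchar K] =i pred0 ->
  prime_ring R ->
  is_subalg A -> fg_subalg A -> (forall x, A x -> central x) ->
  fg_module A ->
  int_closed A -> int_closed (@central K R) ->
  forall (Q : R -> Prop), is_max_ideal A Q ->
  forall nRA nRB nBA : nat,
    degree A (fun _ => True) nRA -> degree (@central K R) (fun _ => True) nRB ->
    degree A (@central K R) nBA ->
  forall (s : nat) (P : 'I_s -> R -> Prop),
    (* P_1, ..., P_s : the distinct points of the fibre pi^-1(Q) *)
    (forall i, is_max_ideal (@central K R) (P i)) ->
    (forall i x, A x -> (P i x <-> Q x)) ->
    (forall i j, i != j -> exists x, ~ (P i x <-> P j x)) ->
    (forall P' : R -> Prop, is_max_ideal (@central K R) P' ->
       (forall x, A x -> (P' x <-> Q x)) ->
       exists i, forall x, P' x <-> P i x) ->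
  (* e i in B lifts the unit e_i of the local summand B_i of B/mB (B_i <-> P_i) *)
  forall e : 'I_s -> R,
    (forall i, central (e i)) ->
    (forall i, ext_ideal (@central K R) Q (e i * e i - e i)) ->
    (forall i, P i (e i - 1)) ->
    (forall i j, i != j -> P j (e i)) ->
  forall NQ : R -> 'M[K]_nRA, attached A Q NQ ->
  forall MP : 'I_s -> R -> 'M[K]_nRB,
    (forall i, attached (@central K R) (P i) (MP i)) ->
  exists h : 'I_s -> nat,
    [/\ (forall i, 0 < h i)%N,
        (* h_i = Q(t_{B/A}(e_i)) *)
        (forall i t lam, red_trace A (@central K R) (e i) t -> eval_at Q t lam ->
            lam = (h i)%:R),
        (\sum_i h i)%N = nBA
      & iso_dsum NQ MP h].
Proof.
move=> charK Rprime sA _ cA fgA intA intB Q Qmax nRA nRB nBA.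
move=> [nM1 [nZ1 [d1 [rM1 rZ1 nM1E nRAE]]]] [nM2 [nZ2 [d2 [rM2 rZ2 nM2E nRBE]]]].
move=> [nM3 [nZ3 [d3 [rM3 rZ3 nM3E nBAE]]]] s P Pmax PQ _ Pall e cE _ e1 e0 NQ NQatt MP MPatt.
have sB : is_subalg (@central K R).
  split=> [y|x y cx cy r|x y cx cy r|c x cx r]; first by rewrite mul1r mulr1.
  - by rewrite mulrDl mulrDr cx cy.
  - by rewrite -mulrA cy mulrA cx mulrA.
  - by rewrite -scalerAl -scalerAr cx.
pose As := CentralSubalg sA cA Rprime.
pose Bs := CentralSubalg sB (fun x h => h) Rprime.
have AB x : As x -> Bs x by exact: cA.
have sT := full_subalg R.
have subA (a : R) (_ : As a) : (fun _ : R => True) a by [].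
have subB (a : R) (_ : Bs a) : (fun _ : R => True) a by [].
have ZT x : Zof (fun _ : R => True) x <-> central x.
  by split=> [[_ h] y|h]; [exact: h|split=> // y _; exact: h].
have ZB x : Zof (@central K R) x <-> central x.
  by split=> [[]|h] //; split=> // y _; exact: h.
(* The centers of R and of B are both B, so the ranks of centers over A all equal the rank of B. *)
have eZ1 : nZ1 = nM3.
  exact: (@rank_over_uniq K R As (@central K R) nZ1 nM3 sB AB (@rank_over_eq K R As _ _ _ ZT rZ1) rM3).
have eZ3 : nZ3 = nM3.
  exact: (@rank_over_uniq K R As (@central K R) nZ3 nM3 sB AB (@rank_over_eq K R As _ _ _ ZB rZ3) rM3).
have [x xB] := @rank_basis K R Bs _ _ rM2.
have [z zB] := @rank_basis K R As _ _ rM3.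
have yB := tower_is_basis AB xB zB.
have nM3gt0 : (0 < nM3)%N by exact: (basis_gt0 sB zB).
have nM2gt0 : (0 < nM2)%N by exact: (basis_gt0 sT xB).
have eM1 : nM1 = (nM2 * nM3)%N.
  exact: (@rank_over_uniq K R As _ _ _ sT subA rM1 (basis_rank sT subA yB)).
have eZ2 : nZ2 = 1%N.
  apply: (@rank_over_uniq K R Bs (@central K R) nZ2 1%N sB (fun x h => h)
    (@rank_over_eq K R Bs _ _ _ ZT rZ2)).
  apply: (@basis_rank K R Bs (@central K R) sB (fun x h => h) _ (fun _ : 'I_1 => 1)); split.
  - by move=> _; exact: (subalg1 Bs).
  - apply/(indepE Bs) => c; rewrite big_ord1 mulr1 => c0 i.
    by apply: subalg_val_inj; rewrite ord1 c0 rmorph0.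
  - move=> b cb; have [b' b'E] := @subalg_elt K R Bs b cb; exists 1; split; first exact: oner_neq0.
    by exists (fun _ => b'); rewrite big_ord1 rmorph1 mul1r mulr1 b'E.
have d3E : d3 = 1%N.
  move: nM3E; rewrite eZ3 -{1}(mul1n nM3) => /eqP; rewrite eqn_pmul2r // => /eqP.
  by case: d3 {nBAE} => [|[|d]].
(* The tower of ranks gives [d1 ^ 2 * nM3 = d2 ^ 2 * nM3]. Thus one factor [1/d2] normalizes both
   reduced traces of R. *)
have d12 : d1 = d2.
  move: nM1E; rewrite eM1 eZ1 nM2E eZ2 muln1 => /eqP; rewrite eqn_pmul2r //.
  by rewrite !mulnn eqn_sqr => /eqP.
have nBA3 : nBA = nM3 by rewrite nBAE d3E mul1n.
have d2gt0 : (0 < d2)%N by move: nM2gt0; rewrite nM2E; case: d2 {nM2E nRBE d12}.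
have [p [g0 g0span]] := fgA.
have g0A (r : R) : exists al : 'I_p -> subalg_type As, r = \sum_j subalg_val (al j) * g0 j.
  have [c [Ac ->]] := g0span r; have [al alE] := @subalg_family K R As _ _ Ac.
  by exists al; apply: eq_bigr => j _; rewrite alE.
have g0B (r : R) : exists al : 'I_p -> subalg_type Bs, r = \sum_j subalg_val (al j) * g0 j.
  have [c [Ac ->]] := g0span r; have [al alE] := @subalg_family K R Bs _ _ (fun j => cA _ (Ac j)).
  by exists al; apply: eq_bigr => j _; rewrite alE.
have [g [Bg gspan]] := fg_center AB xB charK intB g0A.
have nM1E' : (nM2 * nM3 = d2 * d2 * nM3)%N by rewrite nM2E eZ2 muln1.
have rZ1' : rank_over As (Zof (fun _ => True)) nM3 by rewrite -eZ1.
have Qpt : rational_point As Q.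
  apply: (attached_rational charK yB rZ1' nM1E' g0A intA _ Qmax NQatt).
  by rewrite nRAE d12 eZ1 muln_gt0 d2gt0.
have Ppt i : rational_point Bs (P i).
  apply: (attached_rational charK xB rZ2 nM2E g0B intB _ (Pmax i) (MPatt i)).
  by rewrite nRBE eZ2 muln1.
have [e' e'E] := @subalg_family K R Bs _ _ cE.
have e1' i : P i (subalg_val (e' i) - 1) by rewrite e'E; exact: e1.
have e0' i j : i != j -> P j (subalg_val (e' i)) by rewrite e'E; exact: e0.
have [h [hpos htr hsum]] :=
  fibre_trace charK AB zB Bg gspan intA Qpt Ppt PQ Pall e1' e0'.
exists h; split=> //; last 2 first.
- by rewrite nBA3.
- have El : (size (flatten [seq nseq (h i) i | i <- enum 'I_s]) * nRB)%N = nRA.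
    by rewrite size_multiplicity hsum nRBE nRAE eZ1 eZ2 d12 muln1 mulnC.
  exists El; have [NQrep NQss NQtr] := NQatt.
  pose MT i r := (MP i r)^T.
  have MTr i : row_action (MT i).
    have [[r1 rD rM rZ] _ _] := MPatt i; split.
    - by rewrite /MT r1 trmx1.
    - by move=> u v; rewrite /MT rD linearD.
    - by move=> u v; rewrite /MT rM trmx_mul.
    - by move=> c u; rewrite /MT rZ linearZ.
  have MTc i : complemented (MT i) by case: (MPatt i).
  have DT : (fun r => (dsum_rep MP (flatten [seq nseq (h i) i | i <- enum 'I_s]) r)^T)
      = dsum_rep MT (flatten [seq nseq (h i) i | i <- enum 'I_s]).
    by apply: funext => r; exact: dsum_tr.
  apply: iso_of_traces => //; rewrite ?DT; [exact: row_action_dsum|exact: complemented_dsum|].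
  move=> r; rewrite mxtrace_dsum sum_multiplicity.
  (* Let [tB] be the unnormalized trace of [r] over B. By transitivity [NQ r] has trace [1/d2] times
     the value at Q of the B/A-trace of [tB], and [MP i r] has trace [1/d2] times the value of [tB]
     at [P i]; [htr] compares them. *)
  have [tB tBE] := exists_trace xB g0B intB r.
  have tAE := int_traceE AB zB Bg gspan intA (subalg_valP tB).
  have tA1 := mxtrace_tower AB xB zB tBE tAE.
  have rtA := basis_red_trace charK yB rZ1' nM1E' tA1.
  have rtB := basis_red_trace charK xB rZ2 nM2E tBE.
  have MPE i : \tr (MP i r) = d2%:R^-1 * ev (Ppt i) tB.
    have [_ _ MPtr] := MPatt i; apply: MPtr rtB _.
    rewrite /eval_at -scalerA -scalerBr; apply: (ideal_scale (Ppt i)); exact: evP.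
  have -> : \tr (NQ r) = d2%:R^-1 * ev Qpt (int_trace As z (subalg_val tB)).
    apply: NQtr rtA _.
    rewrite /eval_at -scalerA -scalerBr; apply: (ideal_scale Qpt); exact: evP.
  rewrite htr mulr_sumr; apply: eq_bigr => i _.
  by rewrite MPE -[RHS]mulr_natl mulrCA.
(* The ranks packed in [red_trace] force [d = 1], so [t] is the plain trace of [e i]; evaluating
   [htr] at [e i] leaves only the term [h i]. *)
move=> i t lam [At [nM [nZ [d [rM rZ nME tt]]]]] Qt.
have enM : nM = nM3 := @rank_over_uniq K R As (@central K R) _ _ sB AB rM rM3.
have enZ : nZ = nM3.
  exact: (@rank_over_uniq K R As (@central K R) _ _ sB AB (@rank_over_eq K R As _ _ _ ZB rZ) rM3).
have dE : d = 1%N.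
  move: nME; rewrite enM enZ -{1}(mul1n nM3) => /eqP; rewrite eqn_pmul2r // => /eqP.
  by case: d {tt} => [|[|d]].
subst d; rewrite scale1r enM in tt.
have [t' t'E] := @subalg_elt K R As t At.
have Be := subalg_valP (e' i).
have tE : t' = int_trace As z (subalg_val (e' i)).
  apply: (trL_uniq sB zB Be); first by rewrite t'E e'E.
  exact: (trL_mxtrace sB AB zB Be (int_traceE AB zB Bg gspan intA Be)).
have <- : ev Qpt t' = lam by apply/evE; rewrite t'E.
rewrite tE htr (bigD1 i) //= big1 ?addr0 => [|j ji].
  have -> : ev (Ppt i) (e' i) = 1 by apply/evE; rewrite scale1r.
  by rewrite mulr1.
have -> : ev (Ppt j) (e' i) = 0 by apply/ev_eq0; apply: e0'; rewrite eq_sym.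
by rewrite mulr0.
Qed.
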